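(* Let $L$ be a countable signature containing the symbols $=$ and $\neq$, let $\{\mathcal{B}_i : i \in \omega\}$ be pairwise non-isomorphic $L$-structures with domains contained in $\omega$, and let $\mathfrak{K}$ be the class of all $L$-structures with domain contained in $\omega$ that are isomorphic to some $\mathcal{B}_i$. Then the following are equivalent: (1) $\mathfrak{K}$ is $\mathbf{TxtEx}$-learnable; (2) $\mathfrak{K} \leq_{\textnormal{Scott}} \tilde{\mathcal{E}}$; (3) there is a sequence of $\Sigma^p_2$ sentences $\{\psi_i : i\in\omega\}$ such that for all $i,j$: $\mathcal{B}_j \models \psi_i$ if and only if $i=j$.
   Context: Structures have domains contained in $\omega$. The signature always contains $=$ and $\neq$ as (positive) atomic symbols, so $x\neq y$ counts as a positive atomic formula. $Atm$ is the set of Gödel numbers of all positive and negative atomic sentences of $L\cup\omega$ (the natural numbers added as constants); $Atm_+$ is the set of the positive ones. For a structure $\mathcal{A}$, $\mathcal{D}(\mathcal{A})\subseteq Atm$ is its atomic diagram (positive and negated atomic sentences true in $\mathcal{A}$) and $\mathcal{D}_+(\mathcal{A})\subseteq Atm_+$ its positive atomic diagram; both are regarded as subsets of $\omega$. Learning: a text for $\mathcal{S}$ is a sequence $(\psi_0,\psi_1,\dots)$ of elements of $Atm_+$ with $\{\psi_k : k\in\omega\} = \mathcal{D}_+(\mathcal{S})$; $\mathbb{T}\upharpoonright n=(\psi_k)_{k<n}$. A learner is any function $M$ from finite sequences of elements of $Atm$ to $\omega\cup\{?\}$. $\mathfrak{K}$ (whose isomorphism types are those of $\mathcal{B}_i$,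 $i\in\omega$) is $\mathbf{TxtEx}$-learnable if there is a learner $M$ such that for every $\mathcal{S}\in\mathfrak{K}$ and every text $\mathbb{T}$ for $\mathcal{S}$, $\lim_n M(\mathbb{T}\upharpoonright n)$ exists, equals some $i\in\omega$, and $\mathcal{B}_i\cong\mathcal{S}$. Scott-continuous embedding: $\mathcal{P}(\omega)$ carries the Scott topology (basic open sets $\{A : D\subseteq A\}$ for finite $D$); equivalently $\Gamma:\mathcal{P}(\omega)\to\mathcal{P}(\omega)$ is Scott-continuous iff it is monotone and $x\in\Gamma(A)$ iff $x\in\Gamma(D)$ for some finite $D\subseteq A$. $\Gamma:\mathfrak{K}_0\leq_{\textnormal{Scott}}\mathfrak{K}_1$ means $\Gamma$ is Scott-continuous, for every $\mathcal{A}\in\mathfrak{K}_0$ the set $\Gamma(\mathcal{D}_+(\mathcal{A}))$ is the positive atomic diagram of some structure $\Gamma(\mathcal{A})\in\mathfrak{K}_1$, and for all $\mathcal{A},\mathcal{B}\in\mathfrak{K}_0$: $\mathcal{A}\cong\mathcal{B}$ iff $\Gamma(\mathcal{A})\cong\Gamma(\mathcal{B})$. $\mathfrak{K}_0\leq_{\textnormal{Scott}}\mathfrak{K}_1$ means such $\Gamma$ exists. Equivalence structures are structures $(A;\sim)$ (signature $\{\sim,=,\neq\}$) with $\sim$ an equivalence relation; $[\alpha_1:\beta_1,\dots,\alpha_n:\beta_n]$ denotes the equivalence structure with exactly $\beta_i$ classes of size $\alpha_i$ for each $i$ and no other classes. $\tilde{\mathcal{E}}$ is the class of all equivalence structures with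 domain contained in $\omega$ isomorphic to $[\omega:\omega, n:\omega]$ for some $n\geq1$. Positive infinitary formulas: $\Sigma^p_0$ formulas are finite conjunctions of atomic formulas; $\Pi^p_0$ formulas are finite disjunctions of negations of atomic formulas; $\Sigma^p_1$ formulas have the form $\bigvee_{i\in I}\exists\bar{x}_i\,\psi_i(\bar u,\bar x_i)$ with $\psi_i$ $\Sigma^p_0$ and $I$ countable; $\Pi^p_1$ formulas have the form $\bigwedge_{i\in I}\forall\bar x_i\,\psi_i(\bar u,\bar x_i)$ with $\psi_i$ $\Pi^p_0$, $I$ countable; $\Sigma^p_2$ formulas have the form $\bigvee_{i\in I}\exists\bar x_i(\xi_i(\bar u,\bar x_i)\wedge\psi_i(\bar u,\bar x_i))$ where $I$ is countable and for each $i$ there is $\beta_i<2$ with $\xi_i$ a $\Sigma^p_{\beta_i}$ formula and $\psi_i$ a $\Pi^p_{\beta_i}$ formula. *)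

(* Defs.v *)
From HB Require Import structures.
From mathcomp Require Import all_boot.
From mathcomp Require Import boolp classical_sets functions cardinality.
From mathcomp Require Import filter topology_structure.

Set Implicit Arguments.
Unset Strict Implicit.
Unset Printing Implicit Defensive.

Local Open Scope classical_set_scope.
Local Open Scope card_scope.

(* A countable first-order signature. The symbols = and <> belong to every
   signature and are not listed here: they are the constructors [Eq] and [Neq]
   of [atom]. Individual constants are function symbols of arity 0. *)
Record signature := Signature {
  relsym : countType;
  relar : relsym -> nat;
  funsym : countType;
  funar : funsym -> nat }.

(* As usual in model theory, domains are nonempty; [dom] is used as the type of
   its elements through the coercion [set_type]. *)
Record structure (L : signature) := Structure {
  dom :> set nat;
  dom_neq0 : dom !=set0;
  rel_interp : forall r : relsym L, {ffun 'I_(relar r) -> dom} -> Prop;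
  fun_interp : forall f : funsym L, {ffun 'I_(funar f) -> dom} -> dom }.

Definition iso (L : signature) (A B : structure L) : Prop :=
  exists h : dom A -> dom B,
    [/\ bijective h,
        forall r (a : {ffun 'I_(relar r) -> dom A}),
          rel_interp a <-> rel_interp [ffun k => h (a k)]
      & forall f (a : {ffun 'I_(funar f) -> dom A}),
          h (fun_interp a) = fun_interp [ffun k => h (a k)]].

Section Syntax.
Variable L : signature.

(* The leaves [V] serve both as variables and as added constants: atomic
   sentences of L + omega are the elements of [atom L nat], and atomic
   formulas with free variables in [V] are those of [atom L V]. *)
Inductive term (V : Type) :=
| Leaf of V
| App (f : funsym L) of {ffun 'I_(funar f) -> term V}.

Inductive atom (V : Type) :=
| Eq of term V & term V
| Neq of term V & term V
| Rel (r : relsym L) of {ffun 'I_(relar r) -> term V}.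

Fixpoint map_term (V W : Type) (g : V -> W) (t : term V) : term W :=
  match t with
  | Leaf v => Leaf (g v)
  | App f ts => App [ffun k => map_term g (ts k)]
  end.

Definition map_atom (V W : Type) (g : V -> W) (phi : atom V) : atom W :=
  match phi with
  | Eq s t => Eq (map_term g s) (map_term g t)
  | Neq s t => Neq (map_term g s) (map_term g t)
  | Rel r ts => Rel [ffun k => map_term g (ts k)]
  end.

Fixpoint eval (A : structure L) (V : Type) (u : V -> dom A) (t : term V)
    : dom A :=
  match t with
  | Leaf v => u v
  | App f ts => fun_interp [ffun k => eval u (ts k)]
  end.

Definition holds (A : structure L) (V : Type) (u : V -> dom A) (phi : atom V)
    : Prop :=
  match phi with
  | Eq s t => eval u s = eval u t
  | Neq s t => eval u s <> eval u t
  | Rel r ts => rel_interp [ffun k => eval u (ts k)]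
  end.

End Syntax.
Arguments Leaf {L V}.
Arguments App {L V}.
Arguments Eq {L V}.
Arguments Neq {L V}.
Arguments Rel {L V}.

Section Countability.
Variables (L : signature) (V : countType).

Lemma term_ind' (P : term L V -> Prop) :
  (forall v, P (Leaf v)) ->
  (forall f (ts : {ffun 'I_(funar f) -> term L V}),
     (forall k, P (ts k)) -> P (App f ts)) ->
  forall t, P t.
Proof.
move=> Pleaf Papp; fix IH 1 => -[v|f ts]; first exact: Pleaf.
by apply: Papp => k; apply: IH.
Qed.

Fixpoint tree_of_term (t : term L V) : GenTree.tree (V + funsym L) :=
  match t with
  | Leaf v => GenTree.Leaf (inl v)
  | App f ts =>
      GenTree.Node 0 (GenTree.Leaf (inr f) :: codom (tree_of_term \o ts))
  end.

Fixpoint term_of_tree (w : GenTree.tree (V + funsym L)) : option (term L V) :=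
  match w with
  | GenTree.Leaf (inl v) => Some (Leaf v)
  | GenTree.Node _ (GenTree.Leaf (inr f) :: ws) =>
      omap (fun ts : #|'I_(funar f)|.-tuple (term L V) => App f (Finfun ts))
        (insub (pmap term_of_tree ws))
  | _ => None
  end.

Lemma tree_of_termK : pcancel tree_of_term term_of_tree.
Proof.
elim/term_ind' => [//|f ts IH] /=.
have -> : pmap term_of_tree (codom (tree_of_term \o ts)) = fgraph ts.
  rewrite -codom_ffun /codom /image_mem.
  by elim: (enum _) => //= k s ->; rewrite IH.
by rewrite valK /= fgraphK.
Qed.

HB.instance Definition _ := Countable.copy (term L V) (pcan_type tree_of_termK).

Definition sum_of_atom (phi : atom L V) :
    term L V * term L V + term L V * term L V +
    {r : relsym L & {ffun 'I_(relar r) -> term L V}} :=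
  match phi with
  | Eq s t => inl (inl (s, t))
  | Neq s t => inl (inr (s, t))
  | Rel r ts => inr (existT _ r ts)
  end.

Definition atom_of_sum
    (w : term L V * term L V + term L V * term L V +
         {r : relsym L & {ffun 'I_(relar r) -> term L V}}) : atom L V :=
  match w with
  | inl (inl st) => Eq st.1 st.2
  | inl (inr st) => Neq st.1 st.2
  | inr (existT r ts) => Rel r ts
  end.

Lemma sum_of_atomK : cancel sum_of_atom atom_of_sum.
Proof. by case. Qed.

HB.instance Definition _ := Countable.copy (atom L V) (can_type sum_of_atomK).

End Countability.

Section Diagrams.
Variable L : signature.

(* [(true, phi)] stands for the atomic sentence phi of L + omega and
   [(false, phi)] for its negation. *)
Definition godel (phi : bool * atom L nat) : nat := pickle phi.

Definition Atm : set nat := range godel.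

(* Only sentences whose added constants lie in the domain can be true in A:
   these are the images of the atomic sentences of L + dom A. *)
Definition Dplus (A : structure L) : set nat :=
  [set godel (true, map_atom (@set_val _ (dom A)) phi) |
     phi in [set phi : atom L (dom A) | holds id phi]].

(* The sentences of a text lie in Atm_+ because Dplus A does. *)
Definition is_text (A : structure L) (T : nat -> Atm) : Prop :=
  [set set_val (T k) | k in [set: nat]] = Dplus A.

Definition copies (B : nat -> structure L) : set (structure L) :=
  [set A | exists i, iso (B i) A].

(* [None] is the conjecture "?", and [mkseq T n] is the prefix of T of
   length n. *)
Definition TxtEx_learnable (B : nat -> structure L) (K : set (structure L))
    : Prop :=
  exists M : seq Atm -> option nat,
    forall S, K S -> forall T, is_text S T ->
      exists i : nat,
        (exists n0, forall n, n0 <= n -> M (mkseq T n) = Some i) /\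
        iso (B i) S.

End Diagrams.

(* The powerset of omega with the Scott topology. *)
Definition Pomega := set nat.

HB.instance Definition _ := Choice.on Pomega.

Definition Scott_basic (D : set nat) : set Pomega := [set A | D `<=` A].

Lemma Scott_basic_cover :
  \bigcup_(D in [set D | finite_set D]) Scott_basic D = setT.
Proof.
by apply/seteqP; split=> // A _; exists set0 => //=; apply: finite_set0.
Qed.

Lemma Scott_basic_join (D E : set nat) (A : Pomega) :
  finite_set D -> finite_set E -> Scott_basic D A -> Scott_basic E A ->
  exists F, [/\ finite_set F, Scott_basic F A
               & Scott_basic F `<=` Scott_basic D `&` Scott_basic E].
Proof.
move=> fD fE DA EA; exists (D `|` E); split.
- by rewrite finite_setU.
- by rewrite /Scott_basic /= subUset.
- by move=> C; rewrite /Scott_basic /= subUset.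
Qed.

HB.instance Definition _ :=
  isBaseTopological.Build Pomega Scott_basic_cover Scott_basic_join.

Lemma Scott_nbhsP (A : Pomega) (U : set Pomega) :
  nbhs A U <->
  exists D, [/\ finite_set D, D `<=` A & Scott_basic D `<=` U].
Proof.
rewrite nbhsE /=; split.
  case=> V [[D' sD' <-] [D D'D DA]] sVU; exists D; split => //; first exact: sD'.
  by move=> C DC; apply: sVU; exists D.
case=> D [fD DA sDU]; exists (Scott_basic D) => //; split=> //.
by exists [set D]; [move=> _ -> | rewrite bigcup_set1].
Qed.

Lemma Scott_continuousP (G : Pomega -> Pomega) :
  continuous G <->
  (forall A B : Pomega, A `<=` B -> G A `<=` G B) /\
  (forall (A : Pomega) x, G A x ->
     exists D : Pomega, [/\ finite_set D, D `<=` A & G D x]).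
Proof.
have one x : finite_set [set x : nat] by exact: finite_set1.
have key A x : continuous G -> G A x ->
    exists D, [/\ finite_set D, D `<=` A & forall C, D `<=` C -> G C x].
  move=> cG GAx.
  have /cG/Scott_nbhsP [D [fD DA sD]] : nbhs (G A) (Scott_basic [set x]).
    by apply/Scott_nbhsP; exists [set x]; split => // _ ->.
  by exists D; split => // C DC; apply: (sD C DC).
split=> [cG|[mG fG] A U /Scott_nbhsP [D [fD DA sDU]]].
  split=> [A B AB x /(key _ _ cG) [D [_ DA h]]|A x /(key _ _ cG) [D [fD DA h]]].
    exact/h/(subset_trans DA).
  by exists D; split => //; apply: h.
apply/Scott_nbhsP.
have /choice [h hP] : forall x, exists E : Pomega,
    [/\ finite_set E, E `<=` A & D x -> G E x].
  move=> x; have [/DA/fG [E [? ? ?]]|nD] := pselect (D x); first by exists E.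
  by exists set0; split => //; exact: finite_set0.
exists (\bigcup_(x in D) h x); split.
- by apply: bigcup_finite => // x _; case: (hP x).
- by move=> y [x _ hxy]; case: (hP x) => _ + _; apply.
move=> C hC; apply: sDU => x Dx.
by apply: (mG (h x)); [move=> y hy; apply: hC; exists x | case: (hP x) => _ _; apply].
Qed.

(* Since a structure is determined by its positive atomic diagram,
   [F A] is the structure with diagram [Gamma (Dplus A)]. *)
Definition Scott_le (L0 L1 : signature)
    (K0 : set (structure L0)) (K1 : set (structure L1)) : Prop :=
  exists Gamma : Pomega -> Pomega, continuous Gamma /\
  exists F : structure L0 -> structure L1,
    (forall A, K0 A -> K1 (F A) /\ Gamma (Dplus A) = Dplus (F A)) /\
    (forall A B, K0 A -> K0 B -> (iso A B <-> iso (F A) (F B))).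

Definition eq_signature : signature :=
  {| relsym := unit; relar := fun=> 2; funsym := void; funar := fun=> 0 |}.

Section EquivalenceStructures.
Variable E : structure eq_signature.

Definition sim (x y : dom E) : Prop :=
  @rel_interp _ E tt [ffun k : 'I_2 => if k == ord0 then x else y].

Definition equivalence_structure : Prop :=
  [/\ forall x, sim x x,
      forall x y, sim x y -> sim y x
    & forall x y z, sim x y -> sim y z -> sim x z].

Definition sim_classes : set (set (dom E)) := range sim.

(* [has_type [:: (a1, b1); ...; (an, bn)]] says that E is of the form
   [a1 : b1, ..., an : bn]; a cardinal m <= omega is given by a set of natural
   numbers of that cardinality: `I_m for m finite, [set: nat] for omega. *)
Definition has_type (s : seq (set nat * set nat)) : Prop :=
  (forall ab, ab \in s ->
     [set C | sim_classes C /\ C #= ab.1] #= ab.2) /\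
  (forall C, sim_classes C -> exists2 ab, ab \in s & C #= ab.1).

End EquivalenceStructures.

Definition Etilde : set (structure eq_signature) :=
  [set E | equivalence_structure E /\
     exists2 n, 1 <= n &
       has_type E [:: ([set: nat], [set: nat]); (`I_n, [set: nat])]].

Section PositiveFormulas.
Variable L : signature.

(* Formulas with free variables in V; a block of m quantified variables adds
   the variables 'I_m. Sentences are the formulas with V = void. *)

Definition Sigma0 (V : Type) := seq (atom L V).

(* The list of the atomic formulas whose negations form the disjunction. *)
Definition Pi0 (V : Type) := seq (atom L V).

Record Sigma1 (V : Type) := MkSigma1 {
  sigma1_index : countType;
  sigma1_arity : sigma1_index -> nat;
  sigma1_body : forall i, Sigma0 (V + 'I_(sigma1_arity i)) }.

Record Pi1 (V : Type) := MkPi1 {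
  pi1_index : countType;
  pi1_arity : pi1_index -> nat;
  pi1_body : forall i, Pi0 (V + 'I_(pi1_arity i)) }.

Variant Sigma_and_Pi (V : Type) :=
| Beta0 of Sigma0 V & Pi0 V
| Beta1 of Sigma1 V & Pi1 V.

Record Sigma2 (V : Type) := MkSigma2 {
  sigma2_index : countType;
  sigma2_arity : sigma2_index -> nat;
  sigma2_body : forall i, Sigma_and_Pi (V + 'I_(sigma2_arity i)) }.

Section Satisfaction.
Variable A : structure L.

Definition extend (V : Type) (m : nat) (u : V -> dom A) (x : 'I_m -> dom A)
    (v : V + 'I_m) : dom A :=
  match v with inl w => u w | inr k => x k end.

Definition sat_Sigma0 (V : Type) (u : V -> dom A) (F : Sigma0 V) : Prop :=
  foldr and True [seq holds u phi | phi <- F].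

Definition sat_Pi0 (V : Type) (u : V -> dom A) (F : Pi0 V) : Prop :=
  foldr or False [seq ~ holds u phi | phi <- F].

Definition sat_Sigma1 (V : Type) (u : V -> dom A) (F : Sigma1 V) : Prop :=
  exists (i : sigma1_index F) (x : 'I_(sigma1_arity i) -> dom A),
    sat_Sigma0 (extend u x) (sigma1_body i).

Definition sat_Pi1 (V : Type) (u : V -> dom A) (F : Pi1 V) : Prop :=
  forall (i : pi1_index F) (x : 'I_(pi1_arity i) -> dom A),
    sat_Pi0 (extend u x) (pi1_body i).

Definition sat_Sigma_and_Pi (V : Type) (u : V -> dom A) (F : Sigma_and_Pi V)
    : Prop :=
  match F with
  | Beta0 xi psi => sat_Sigma0 u xi /\ sat_Pi0 u psi
  | Beta1 xi psi => sat_Sigma1 u xi /\ sat_Pi1 u psi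
  end.

Definition sat_Sigma2 (V : Type) (u : V -> dom A) (F : Sigma2 V) : Prop :=
  exists (i : sigma2_index F) (x : 'I_(sigma2_arity i) -> dom A),
    sat_Sigma_and_Pi (extend u x) (sigma2_body i).

Definition models (F : Sigma2 void) : Prop :=
  sat_Sigma2 (of_void (dom A)) F.

End Satisfaction.
End PositiveFormulas.

(* Main.v *)
Require Import Defs.
From mathcomp Require Import all_boot.
From mathcomp Require Import boolp classical_sets functions cardinality.
From mathcomp Require Import filter topology_structure.
From mathcomp Require Import zify.

(* Each of the three conditions is equivalent to: for every [i], the copies of
   [B i] are separated from the other structures of the class by a countable
   union of differences of Scott-open sets of positive diagrams ([Sig2]).
   From a learner one gets this description by locking sequences, and a learner
   can conversely follow the least alternative that is supported and not yet
   refuted. A reduction to equivalence structures pulls back the description of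
   having a class with exactly n elements; conversely each alternative for [B i]
   becomes infinitely many classes which have [i.+1] elements when the
   alternative is supported and become infinite when it is refuted. A Sigma^p_2
   sentence is such a description in which the alternatives only mention the
   elements named by a tuple; conversely the sentence expressing that some
   alternative is forced, in the sense of finite partial enumerations of the
   structure, holds in [B i] because a generic copy of [B i] satisfies some
   alternative. *)

Set Implicit Arguments.
Unset Strict Implicit.
Unset Printing Implicit Defensive.

Local Open Scope classical_set_scope.
Local Open Scope card_scope.

(** * Renaming and evaluation of atomic formulas *)

Section Leaves.
Variable L : signature.

Lemma term_indT (V : Type) (P : term L V -> Prop) :
  (forall v, P (Leaf v)) ->
  (forall f (ts : {ffun 'I_(funar f) -> term L V}),
     (forall k, P (ts k)) -> P (App f ts)) ->
  forall t, P t.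
Proof.
move=> Pleaf Papp; fix IH 1 => -[v|f ts]; first exact: Pleaf.
by apply: Papp => k; apply: IH.
Qed.

Fixpoint leaf_of (V : Type) (v : V) (t : term L V) : Prop :=
  match t with
  | Leaf w => v = w
  | App f ts => exists k, leaf_of v (ts k)
  end.

Definition occurs (V : Type) (v : V) (phi : atom L V) : Prop :=
  match phi with
  | Eq s t => leaf_of v s \/ leaf_of v t
  | Neq s t => leaf_of v s \/ leaf_of v t
  | Rel r ts => exists k, leaf_of v (ts k)
  end.

Lemma leaf_of_mapE (V W : Type) (g : V -> W) (t : term L V) w :
  leaf_of w (map_term g t) -> exists v, w = g v.
Proof.
elim/term_indT: t => [v /= ->|f ts IH [k /= kw]]; first by exists v.
by apply: (IH k); rewrite ffunE in kw.
Qed.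

Lemma occurs_mapE (V W : Type) (g : V -> W) (phi : atom L V) w :
  occurs w (map_atom g phi) -> exists v, w = g v.
Proof.
case: phi => [s t|s t|r ts] => [[|]|[|]|]; try exact: leaf_of_mapE.
by move=> [k kw]; apply: (@leaf_of_mapE _ _ g (ts k)); rewrite ffunE in kw.
Qed.

Lemma eq_map_term (V W : Type) (g g' : V -> W) (t : term L V) :
  (forall v, leaf_of v t -> g v = g' v) -> map_term g t = map_term g' t.
Proof.
elim/term_indT: t => [v /= ->//|f ts IH /= gg'].
congr App; apply/ffunP => k; rewrite !ffunE; apply: IH => v kv.
by apply: gg'; exists k.
Qed.

Lemma eq_map_atom (V W : Type) (g g' : V -> W) (phi : atom L V) :
  (forall v, occurs v phi -> g v = g' v) -> map_atom g phi = map_atom g' phi.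
Proof.
case: phi => [s t|s t|r ts] /= gg'.
- by congr Eq; apply: eq_map_term => v vP; apply: gg'; [left|right].
- by congr Neq; apply: eq_map_term => v vP; apply: gg'; [left|right].
- congr Rel; apply/ffunP => k; rewrite !ffunE; apply: eq_map_term => v vP.
  by apply: gg'; exists k.
Qed.

Lemma map_term_comp (V W X : Type) (g : V -> W) (h : W -> X) (t : term L V) :
  map_term h (map_term g t) = map_term (h \o g) t.
Proof.
elim/term_indT: t => [//|f ts IH] /=.
by congr App; apply/ffunP => k; rewrite !ffunE IH.
Qed.

Lemma map_atom_comp (V W X : Type) (g : V -> W) (h : W -> X) (phi : atom L V) :
  map_atom h (map_atom g phi) = map_atom (h \o g) phi.
Proof.
case: phi => [s t|s t|r ts] /=; rewrite ?map_term_comp//.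
by congr Rel; apply/ffunP => k; rewrite !ffunE map_term_comp.
Qed.

Lemma map_atom_id (V : Type) (phi : atom L V) : map_atom id phi = phi.
Proof.
have idt (t : term L V) : map_term id t = t.
  elim/term_indT: t => [//|f ts IH] /=.
  by congr App; apply/ffunP => k; rewrite !ffunE IH.
case: phi => [s t|s t|r ts] /=; rewrite ?idt//.
by congr Rel; apply/ffunP => k; rewrite !ffunE idt.
Qed.

Variables A : structure L.

Lemma eval_map (V W : Type) (g : V -> W) (u : W -> dom A) (t : term L V) :
  eval u (map_term g t) = eval (u \o g) t.
Proof.
elim/term_indT: t => [//|f ts IH] /=.
by congr fun_interp; apply/ffunP => k; rewrite !ffunE IH.
Qed.

Lemma holds_map (V W : Type) (g : V -> W) (u : W -> dom A) (phi : atom L V) :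
  holds u (map_atom g phi) <-> holds (u \o g) phi.
Proof.
case: phi => [s t|s t|r ts] /=; rewrite ?eval_map//.
have -> // : [ffun k => eval u ([ffun k0 => map_term g (ts k0)] k)] =
            [ffun k => eval (u \o g) (ts k)].
by apply/ffunP => k; rewrite !ffunE eval_map.
Qed.

Lemma eq_eval (V : Type) (u u' : V -> dom A) (t : term L V) :
  (forall v, leaf_of v t -> u v = u' v) -> eval u t = eval u' t.
Proof.
elim/term_indT: t => [v /= ->//|f ts IH /= gg'].
congr fun_interp; apply/ffunP => k; rewrite !ffunE; apply: IH => v kv.
by apply: gg'; exists k.
Qed.

Lemma eq_holds (V : Type) (u u' : V -> dom A) (phi : atom L V) :
  (forall v, occurs v phi -> u v = u' v) -> holds u phi <-> holds u' phi.
Proof.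
case: phi => [s t|s t|r ts] /= uu'.
- by rewrite (eq_eval (u' := u') (t := s)) ?(eq_eval (u' := u') (t := t)) // => v vP;
    apply: uu'; [right|left].
- by rewrite (eq_eval (u' := u') (t := s)) ?(eq_eval (u' := u') (t := t)) // => v vP;
    apply: uu'; [right|left].
- have -> // : [ffun k => eval u (ts k)] = [ffun k => eval u' (ts k)].
  apply/ffunP => k; rewrite !ffunE; apply: eq_eval => v vP.
  by apply: uu'; exists k.
Qed.

End Leaves.

(** * Isomorphisms and invariance of atomic truth *)

Section Isomorphism.
Variable L : signature.
Implicit Types A B C : structure L.

(** Bijectivity is kept apart from the compatibility conditions, so that with injectivity alone they
    describe embeddings of substructures. *)
Definition isom A B (h : dom A -> dom B) : Prop :=
  (forall r (a : {ffun 'I_(relar r) -> dom A}),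
          rel_interp a <-> rel_interp [ffun k => h (a k)]) /\
  (forall f (a : {ffun 'I_(funar f) -> dom A}),
          h (fun_interp a) = fun_interp [ffun k => h (a k)]).

Lemma isoP A B : iso A B <-> exists2 h : dom A -> dom B, bijective h & isom h.
Proof. by split=> [[h [? ? ?]]|[h ? []]]; exists h. Qed.

Lemma iso_refl A : iso A A.
Proof.
have idE T n (a : {ffun 'I_n -> T}) : [ffun k => a k] = a.
  by apply/ffunP => k; rewrite ffunE.
by exists id; split=> [|r a|f a] /=; rewrite ?idE //; exists id.
Qed.

Lemma iso_sym A B : iso A B -> iso B A.
Proof.
case=> h [[g hK gK] hrel hfun]; exists g.
have hgE n (a : {ffun 'I_n -> dom B}) :
    [ffun k => h ([ffun k0 => g (a k0)] k)] = a.
  by apply/ffunP => k; rewrite !ffunE gK.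
split=> [|r a|f a]; first by exists h.
  by rewrite hrel hgE.
by rewrite -[RHS]hK hfun hgE.
Qed.

Lemma iso_trans A B C : iso A B -> iso B C -> iso A C.
Proof.
case=> h [hbij hrel hfun] [g [gbij grel gfun]]; exists (g \o h).
have hgE n (a : {ffun 'I_n -> dom A}) :
    [ffun k => g ([ffun k0 => h (a k0)] k)] = [ffun k => (g \o h) (a k)].
  by apply/ffunP => k; rewrite !ffunE.
split=> [|r a|f a]; first exact: bij_comp.
  by rewrite hrel grel hgE.
by rewrite /= hfun gfun hgE.
Qed.

Lemma eval_isom A B (h : dom A -> dom B) (V : Type) (u : V -> dom A) t :
  isom h -> eval (h \o u) t = h (eval u t).
Proof.
case=> _ hfun; elim/term_indT: t => [//|f ts IH] /=; rewrite hfun.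
by congr fun_interp; apply/ffunP => k; rewrite !ffunE IH.
Qed.

Lemma holds_isom A B (h : dom A -> dom B) (V : Type) (u : V -> dom A) phi :
  injective h -> isom h -> holds (h \o u) phi <-> holds u phi.
Proof.
move=> hI hiso; case: phi => [s t|s t|r ts] /=; rewrite ?eval_isom//.
- by split=> [/hI|->].
- by split=> e e'; apply: e; [rewrite e'|apply: hI].
- rewrite (proj1 hiso).
  have -> // : [ffun k => eval (h \o u) (ts k)] =
     [ffun k => h ([ffun k0 => eval u (ts k0)] k)].
  by apply/ffunP => k; rewrite !ffunE eval_isom.
Qed.

End Isomorphism.

(** * Positive atomic diagrams *)

Section Diag.
Variable L : signature.
Implicit Types A : structure L.

(* The positive atomic diagram before Goedel numbering. *)
Definition diag A : set (atom L nat) :=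
  [set map_atom (@set_val _ (dom A)) phi |
     phi in [set phi : atom L (dom A) | holds id phi]].

Lemma DplusE A : Dplus A = [set godel (true, phi) | phi in diag A].
Proof. by rewrite /diag image_comp. Qed.

Lemma godel_inj : injective (fun phi : atom L nat => godel (true, phi)).
Proof. by move=> phi psi /(pcan_inj pickleK) []. Qed.

Lemma Dplus_godel A phi : Dplus A (godel (true, phi)) <-> diag A phi.
Proof.
rewrite DplusE; split=> [[psi ? /godel_inj <- //]|?]; by exists phi.
Qed.

(** Numbers outside the domain go to an arbitrary element, so that atomic formulas over [nat] can be
    evaluated by a total assignment. *)
Lemma retraction A : exists r : nat -> dom A, cancel set_val r.
Proof.
have [a0 Aa0] := dom_neq0 A.
exists (fun n => odflt (SigSub (mem_set Aa0)) (insub n)) => a.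
by rewrite valK.
Qed.

Lemma diag_map A (V : Type) (nu : V -> nat) (u : V -> dom A) (phi : atom L V) :
  (forall v, set_val (u v) = nu v) -> diag A (map_atom nu phi) <-> holds u phi.
Proof.
move=> uE; split=> [[psi psiA e]|uphi]; last first.
  exists (map_atom u phi) => /=; first exact/holds_map.
  by rewrite map_atom_comp; apply: eq_map_atom => v _ /=; rewrite uE.
have [r rK] := retraction A.
have : holds r (map_atom nu phi).
  rewrite -e; apply/holds_map; move: psiA; congr holds.
  by apply/funext => a /=; rewrite rK.
move/holds_map; congr holds; apply/funext => v /=.
by rewrite -uE rK.
Qed.

(** As [h] need not be onto, the diagrams of many substructures of [B] can be read off a single
    assignment [v]; only the set of available constants varies. *)
Lemma diagP A (B : structure L) (h : dom A -> dom B) (v : nat -> dom B) phi :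
  injective h -> isom h -> (forall a, v (set_val a) = h a) ->
  diag A phi <-> (forall n, occurs n phi -> dom A n) /\ holds v phi.
Proof.
move=> hI hiso vE; split=> [[psi psiA <-]|[occ vphi]].
  split; first by move=> n np; have [a ->] := occurs_mapE np; exact: set_valP.
  apply/holds_map; rewrite (_ : v \o set_val = h \o id); last exact/funext.
  exact/(holds_isom id psi hI hiso).
have [r rK] := retraction A.
have {}rK n (An : dom A n) : set_val (r n) = n.
  by have /(congr1 set_val) := rK (SigSub (mem_set An)).
have -> : phi = map_atom set_val (map_atom r phi).
  rewrite map_atom_comp -[LHS]map_atom_id; apply: eq_map_atom => n /occ /=.
  by move/rK.
apply/(diag_map (u := id)) => //; apply/holds_map.
rewrite -(holds_isom _ _ hI hiso) (eq_holds (u' := v)) // => n /occ An /=.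
by rewrite -vE rK.
Qed.

Lemma diag_dom A n phi : diag A phi -> occurs n phi -> dom A n.
Proof. by case=> psi _ <- np; have [a ->] := occurs_mapE np; exact: set_valP. Qed.

Lemma diag_eqxx A n : diag A (Eq (Leaf n) (Leaf n)) <-> dom A n.
Proof.
split=> [/diag_dom|An]; first by apply; left.
have := @diag_map A unit (fun=> n) (fun=> SigSub (mem_set An))
  (Eq (Leaf tt) (Leaf tt)).
by move=> /= ->.
Qed.

End Diag.

(** * Countable unions of differences of Scott-open sets *)

Section Sig2.
Variable L : signature.
Implicit Types (K : set (structure L)) (P : structure L -> Prop).

(* On the diagrams of the structures in [K], [P] is a countable union of
   differences of Scott-open sets. *)
Definition Sig2 K P : Prop :=
  exists (D : nat -> seq (atom L nat)) (E : nat -> set (seq (atom L nat))),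
    forall S, K S -> P S <->
      exists c, [set` D c] `<=` diag S /\
                forall e, E c e -> ~ [set` e] `<=` diag S.

Lemma Sig2_basic K (d : seq (atom L nat)) (E : set (seq (atom L nat))) :
  Sig2 K (fun S => [set` d] `<=` diag S /\
                   forall e, E e -> ~ [set` e] `<=` diag S).
Proof.
by exists (fun=> d), (fun=> E) => S _; split=> [|[_]//]; exists 0.
Qed.

Lemma Sig2_ex K (J : countType) (P : J -> structure L -> Prop) :
  (forall j, Sig2 K (P j)) -> Sig2 K (fun S => exists j, P j S).
Proof.
move=> /choice[D /choice[E DEP]].
pose jc n : option (J * nat) := unpickle n.
(* Numbers that code no pair get an alternative refuted by the empty list, which is contained in
   every diagram. *)
exists (fun n => if jc n is Some (j, c) then D j c else [::]).
exists (fun n => if jc n is Some (j, c) then E j c else [set [::]]) => S KS.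
split=> [[j /DEP-/(_ KS)[c DEc]]|[n]].
  by exists (pickle (j, c)); rewrite /jc pickleK.
case: (jc n) => [[j c] DEc|[_ /(_ _ erefl)]]; last by case.
by exists j; apply/DEP => //; exists c.
Qed.

Lemma eq_Sig2 K P Q : (forall S, K S -> P S <-> Q S) -> Sig2 K P -> Sig2 K Q.
Proof.
by move=> PQ [D [E DEP]]; exists D, E => S KS; rewrite -PQ //; apply: DEP.
Qed.

Lemma Sig2_and K (p : Prop) P : Sig2 K P -> Sig2 K (fun S => p /\ P S).
Proof.
have [pT|pF] := pselect p; first by apply: eq_Sig2 => S _; split=> [|[]].
move=> _; exists (fun=> [::]), (fun=> [set [::]]) => S _.
split=> [[]//|[_ [_ /(_ _ erefl)]]]; by case.
Qed.

End Sig2.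

(* Rasiowa-Sikorski lemma for the conditions [C] ordered by extension. *)
Lemma generic_sequence (X : Type) (C : seq X -> Prop) (R : nat -> seq X -> Prop)
    (x0 : X) (s0 : seq X) :
  C s0 -> (forall n s, C s -> exists t, C (s ++ t) /\ R n (s ++ t)) ->
  exists (v : nat -> X) (l : nat -> nat),
    [/\ s0 = mkseq v (l 0), forall n, C (mkseq v (l n)),
        forall n, R n (mkseq v (l n.+1)) & {homo l : m n / m <= n}].
Proof.
move=> Cs0 dense.
have /choice[f fP] (ns : nat * seq X) : exists t,
    C ns.2 -> C (ns.2 ++ t) /\ R ns.1 (ns.2 ++ t).
  have [/(dense ns.1)[t]|?] := pselect (C ns.2); first by exists t.
  by exists [::].
pose fix sq n := if n is m.+1 then sq m ++ f (m, sq m) else s0.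
have Csq n : C (sq n).
  by elim: n => //= n IH; have [] := fP (n, sq n) IH.
have sqD m k : exists t, sq (k + m) = sq m ++ t.
  elim: k => [|k [t IH]]; first by exists [::]; rewrite cats0.
  by exists (t ++ f (k + m, sq (k + m))); rewrite addSn /= {1}IH catA.
have sqW m n : m <= n -> exists t, sq n = sq m ++ t.
  by move=> /subnK <-.
have nth_sq m n k : k < size (sq m) -> k < size (sq n) ->
    nth x0 (sq m) k = nth x0 (sq n) k.
  have [/sqW[t ->] km _|/ltnW/sqW[t ->] _ kn] := leqP m n; rewrite nth_cat.
    by rewrite km.
  by rewrite kn.
(* All stages longer than [k] agree at position [k]; if there are none, [x0] is a harmless
   default. *)
have /choice[v vP] k : exists x, forall n, k < size (sq n) -> x = nth x0 (sq n) k.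
  have [[m km]|nk] := pselect (exists m, k < size (sq m)).
    by exists (nth x0 (sq m) k) => n; apply: nth_sq.
  by exists x0 => n kn; case: nk; exists n.
have sqE n : mkseq v (size (sq n)) = sq n.
  apply: (@eq_from_nth _ x0); rewrite size_mkseq // => k kn.
  by rewrite nth_mkseq // (vP _ n).
exists v, (fun n => size (sq n)); split=> [|n|n|m n /sqW[t ->]].
- by rewrite sqE.
- by rewrite sqE.
- by rewrite sqE /=; have [] := fP (n, sq n) (Csq n).
- by rewrite size_cat leq_addr.
Qed.

(** * Learners and texts *)

Section Learning.
Variable L : signature.
Implicit Type S : structure L.

Definition code (phi : atom L nat) : Atm L :=
  SigSub (mem_set (imageT (@godel L) (true, phi))).

Definition facts (s : seq (Atm L)) : set (atom L nat) :=
  [set phi | code phi \in s].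

Lemma code_inj : injective code.
Proof. by move=> phi psi /(congr1 set_val) /godel_inj. Qed.

Lemma is_text_code S (T : nat -> atom L nat) :
  range T = diag S -> is_text S (code \o T).
Proof.
move=> TS; rewrite /is_text DplusE -TS image_comp.
by apply/seteqP; split=> x [n _ <-]; exists n.
Qed.

Lemma is_textP S (T : nat -> Atm L) : is_text S T ->
  exists2 T' : nat -> atom L nat, T = code \o T' & range T' = diag S.
Proof.
rewrite /is_text DplusE => TS.
have /choice[T' T'P] n : exists phi, diag S phi /\ T n = code phi.
  have : [set set_val (T k) | k in [set: nat]] (set_val (T n)) by exists n.
  by rewrite TS => -[phi ? e]; exists phi; split=> //; exact: val_inj.
exists T'; first by apply/funext => n; have [] := T'P n.
apply/seteqP; split=> [_ [n _ <-]|phi Sphi]; first by have [] := T'P n.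
have : [set godel (true, phi) | phi in diag S] (godel (true, phi)) by exists phi.
rewrite -TS => -[n _ e]; exists n => //; apply: godel_inj => /=.
by rewrite -e; have [_ ->] := T'P n.
Qed.

(** The text is built in stages above [s0]: odd stages list the facts of [S] one by one, even stages
    pad with a true equation to reach the required length and then extend to meet [Q]. *)
Lemma generic_text S (s0 : seq (atom L nat)) (Q : seq (atom L nat) -> Prop) :
  [set` s0] `<=` diag S ->
  (forall s, [set` s] `<=` diag S ->
     exists t, [set` s ++ t] `<=` diag S /\ Q (s ++ t)) ->
  exists T : nat -> atom L nat,
    [/\ range T = diag S, mkseq T (size s0) = s0
      & forall N, exists2 n, N <= n & Q (mkseq T n)].
Proof.
move=> s0S QS.
have [n0 Sn0] := dom_neq0 S; have Sphi0 := proj2 (diag_eqxx _ _) Sn0.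
set phi0 := Eq _ _ in Sphi0.
pose R n (s : seq (atom L nat)) := if odd n
  then (forall phi, unpickle n./2 = Some phi -> diag S phi -> phi \in s)
  else n <= size s /\ Q s.
have [|T [l [s0E TS TR lW]]] :=
  @generic_sequence _ (fun s => [set` s] `<=` diag S) R phi0 s0 s0S.
  move=> n s sS; rewrite /R; case: (odd n).
    case: (unpickle n./2 : option (atom L nat)) => [phi|]; last by exists [::]; rewrite cats0.
    have [Sphi|nS] := pselect (diag S phi); last first.
      by exists [::]; rewrite cats0; split=> // _ [<-].
    exists [:: phi]; split.
      by move=> psi /=; rewrite mem_cat inE => /orP[/sS|/eqP ->].
    by move=> _ [<-]; rewrite mem_cat inE eqxx orbT.
  have [|t [tS Qt]] := QS (s ++ nseq n phi0).
    move=> psi /=; rewrite mem_cat => /orP[/sS//|].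
    by move=> /nseqP[->].
  exists (nseq n phi0 ++ t); rewrite catA; split=> //; split=> //.
  by rewrite -catA !size_cat size_nseq; lia.
have Ql n : exists2 m, n <= m & Q (mkseq T m).
  have := TR n.*2; rewrite /R odd_double size_mkseq => -[nl Ql].
  by exists (l n.*2.+1) => //; lia.
exists T; split => //.
  apply/seteqP; split=> [_ [n _ <-]|phi Sphi].
    have := TR n.+1.*2; rewrite /R odd_double size_mkseq => -[nl _].
    apply: (TS n.+1.*2.+1); apply/mapP; exists n => //.
    by rewrite mem_iota /=; lia.
  have := TR (pickle phi).*2.+1; rewrite /R /= odd_double /= uphalf_double pickleK.
  by move=> /(_ _ erefl Sphi)/mapP[n _ ->]; exists n.
by rewrite {1}s0E size_mkseq -s0E.
Qed.

Variable B : nat -> structure L.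
Hypothesis B_noniso : forall i j : nat, i <> j -> ~ iso (B i) (B j).

Lemma iso_inj S i j : iso (B i) S -> iso (B j) S -> i = j.
Proof.
move=> iS jS; apply: contrapT => /B_noniso; apply.
exact/(iso_trans iS)/iso_sym.
Qed.

(* Locking sequences: [S] is a copy of [B i] iff some finite sequence of facts
   of [S] makes the learner guess [i] and no further facts of [S] can make it
   change its mind. *)
Lemma TxtEx_Sig2 : TxtEx_learnable B (copies B) ->
  forall i, Sig2 (copies B) (iso (B i)).
Proof.
move=> [M MP] i; pose M' s := M (map code s).
have M'P S T : copies B S -> range T = diag S -> exists2 j,
    iso (B j) S & exists n0, forall n, n0 <= n -> M' (mkseq T n) = Some j.
  move=> KS /is_text_code/(MP _ KS)[j [[n0 n0P] jS]]; exists j => //.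
  by exists n0 => n /n0P; rewrite /M' /mkseq -map_comp.
(* The refutations of [s] are the extensions that change the guess; the empty list refutes [s]
   outright when its own guess is not [i]. *)
apply: (@eq_Sig2 _ _ (fun S => exists s, [set` s] `<=` diag S /\
   forall e, [set e | e = [::] /\ M' s <> Some i \/
                      exists2 t, e = t & M' (s ++ t) <> Some i] e ->
             ~ [set` e] `<=` diag S)); last first.
  by apply: Sig2_ex => s; apply: Sig2_basic.
move=> S KS; split=> [[s [sS lock]]|iS].
  have lock' t : [set` t] `<=` diag S -> M' (s ++ t) = Some i.
    by move=> tS; apply: contrapT => ne; apply: (lock t) => //; right; exists t.
  (* On a text extending a locking sequence the guess stays [i], so [i] is the limit. *)
  have [|T [TS Ts _]] := @generic_text S s (fun=> True) sS.
    by move=> s1 s1S; exists [::]; rewrite cats0.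
  have [j jS [n0 n0P]] := M'P _ _ KS TS.
  have := n0P (size s + n0) (leq_addl _ _).
  rewrite /mkseq iotaD map_cat -/(mkseq T (size s)) Ts lock'; first by case=> ->.
  by move=> phi /= /mapP[n _ ->]; rewrite -TS; exists n.
apply: contrapT => nolock.
(* Without a locking sequence every finite part extends to one with a wrong guess, which yields a
   text with infinitely many wrong guesses. *)
have [//||T [TS _ TQ]] := @generic_text S [::] (fun s => M' s <> Some i).
  move=> s sS; apply: contrapT => nt; apply: nolock; exists s; split=> // e eP eS.
  apply: nt; case: eP => [[_ ?]|[t et ?]]; first by exists [::]; rewrite cats0.
  exists t; split=> // phi /=; rewrite mem_cat => /orP[/sS//|].
  by rewrite -et => /eS.
have [j jS [n0 n0P]] := M'P _ _ KS TS.
have [n /n0P -> []] := TQ n0.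
by rewrite (iso_inj iS jS).
Qed.

Lemma finite_facts S (T : nat -> atom L nat) (e : seq (atom L nat)) :
  range T = diag S -> [set` e] `<=` diag S ->
  exists n0, forall n, n0 <= n -> [set` e] `<=` facts (mkseq (code \o T) n).
Proof.
move=> <-; elim: e => [|phi e IH] eT; first by exists 0.
have [|n1 n1P] := IH; first by move=> psi pe; apply: eT; rewrite /= inE pe orbT.
have [k _ kT] : range T phi by apply: eT; rewrite /= inE eqxx.
exists (maxn n1 k.+1) => n; rewrite geq_max => /andP[n1n kn] psi /=.
rewrite inE => /orP[/eqP ->|]; last by move/n1P: n1n => /[apply].
by apply/mapP; exists k; rewrite ?mem_iota //= kT.
Qed.

(* The learner proposes the least candidate that is supported and not refuted
   by the facts seen so far. *)
Lemma Sig2_TxtEx : (forall i, Sig2 (copies B) (iso (B i))) ->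
  TxtEx_learnable B (copies B).
Proof.
move=> /choice[D /choice[E DEP]].
pose cand k : option (nat * nat) := unpickle k.
pose ok k (X : set (atom L nat)) := if cand k is Some (i, c)
  then [set` D i c] `<=` X /\ forall e, E i c e -> ~ [set` e] `<=` X else False.
have /choice[M MP] (s : seq (Atm L)) : exists o : option nat,
    forall k, ok k (facts s) -> (forall j, j < k -> ~ ok j (facts s)) ->
              o = omap fst (cand k).
  have [[k kok]|nok] := pselect (exists k, ok k (facts s)); last first.
    by exists None => k kok; case: nok; exists k.
  have ex : exists k, `[< ok k (facts s) >] by exists k; apply/asboolP.
  case: (ex_minnP ex) => m /asboolP mok mmin.
  exists (omap fst (cand m)) => k' k'ok k'min; suff -> : m = k' by [].
  apply/eqP; rewrite eqn_leq mmin /=; last exact/asboolP.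
  by rewrite leqNgt; apply/negP => /k'min/(_ mok).
exists M => S KS T /is_textP[T' -> TS].
have [i iS] := KS.
have factsW n : facts (mkseq (code \o T') n) `<=` diag S.
  move=> phi /mapP[k _ /code_inj ->]; rewrite -TS; by exists k.
(* Each verdict stabilises: a list contained in [diag S] is finite, hence seen at some stage, and
   any other list is never seen. *)
have ok_ev k : exists n0, forall n, n0 <= n ->
    (ok k (facts (mkseq (code \o T') n)) <-> ok k (diag S)).
  rewrite /ok; case: (cand k) => [[j c]|]; last by exists 0.
  have [DS|nDS] := pselect ([set` D j c] `<=` diag S); last first.
    by exists 0 => n _; split=> -[+ _] => // /subset_trans/(_ (factsW n)).
  have [n0 n0P] := finite_facts TS DS.
  have [[e Ee eS]|nE] := pselect (exists2 e, E j c e & [set` e] `<=` diag S).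
    have [n1 n1P] := finite_facts TS eS.
    exists n1 => n /n1P en; split=> -[_ /(_ e Ee)] => // /(_ eS).
  exists n0 => n /n0P Dn; split=> _; split=> // e Ee en; apply: nE; exists e => //.
  exact: subset_trans en (factsW n).
have ex : exists k, `[< ok k (diag S) >].
  have [c DEc] := proj1 (DEP i S KS) iS.
  by exists (pickle (i, c)); apply/asboolP; rewrite /ok /cand pickleK.
case: (ex_minnP ex) => m /asboolP mok mmin.
(* Once the verdicts on all candidates up to the least correct one [m] are final, the learner
   follows [m] forever. *)
have [n0 n0P] : exists n0, forall n, n0 <= n -> forall k, k <= m ->
    (ok k (facts (mkseq (code \o T') n)) <-> ok k (diag S)).
  elim: (m) => [|m' [n1 n1P]].
    by have [n1 n1P] := ok_ev 0; exists n1 => n /n1P nP [].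
  have [n2 n2P] := ok_ev m'.+1; exists (maxn n1 n2) => n.
  rewrite geq_max => /andP[/n1P nP1 /n2P nP2] k.
  by rewrite leq_eqVlt => /orP[/eqP ->|]; last exact: nP1.
move: (mok); rewrite {1}/ok; case candm: (cand m) => [[j c]|//] DEc.
exists j; split; last by apply/DEP => //; exists c.
exists n0 => n /n0P nP; rewrite (MP _ m) ?candm //; first exact/nP.
move=> k km; rewrite nP; last exact: ltnW.
by move=> /asboolP/mmin; rewrite leqNgt km.
Qed.

End Learning.

(** * From positive formulas to diagrams *)

Section FormulasToDiagrams.
Variable L : signature.
Implicit Types A B S : structure L.

Lemma sat_Sigma0_map A (V : countType) (W : Type) (g : V -> W) (u : W -> dom A)
    (F : seq (atom L V)) :
  sat_Sigma0 u (map (map_atom g) F) <->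
  forall phi, phi \in F -> holds (u \o g) phi.
Proof.
rewrite /sat_Sigma0; elim: F => [|phi F IH] //=.
rewrite holds_map IH; split=> [[up uF] psi|uF].
  by rewrite inE => /orP[/eqP ->//|]; exact: uF.
by split=> [|psi psiF]; apply: uF; rewrite inE ?eqxx ?psiF ?orbT.
Qed.

Lemma sat_Pi0E A (V : Type) (u : V -> dom A) (F : Pi0 L V) :
  sat_Pi0 u F <-> ~ sat_Sigma0 u F.
Proof.
rewrite /sat_Pi0 /sat_Sigma0; elim: F => [|phi F IH] /=; first by split=> // /(_ I).
rewrite IH; split=> [[n [p _]|n [_ p]]|n] //.
have [p|np] := pselect (holds u phi); last by left.
by right=> q; apply: n.
Qed.

Lemma extend_comp A B (h : dom A -> dom B) (V : Type) m (u : V -> dom A)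
    (x : 'I_m -> dom A) : extend (h \o u) (h \o x) = h \o extend u x.
Proof. by apply/funext => -[]. Qed.

Lemma models_iso A B (F : Sigma2 L void) : iso A B -> models A F -> models B F.
Proof.
move=> /isoP[h [g hK gK] hiso].
have hI := can_inj hK.
have s0 (V : Type) (u : V -> dom A) (f : Sigma0 L V) :
    sat_Sigma0 (h \o u) f <-> sat_Sigma0 u f.
  rewrite /sat_Sigma0; elim: f => //= phi f ->.
  by rewrite (holds_isom _ _ hI hiso).
have s1 (V : Type) (u : V -> dom A) (f : Sigma1 L V) :
    sat_Sigma1 u f -> sat_Sigma1 (h \o u) f.
  by move=> [i [x ux]]; exists i, (h \o x); rewrite extend_comp s0.
have p1 (V : Type) (u : V -> dom A) (f : Pi1 L V) :
    sat_Pi1 u f -> sat_Pi1 (h \o u) f.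
  move=> uf i x; rewrite (_ : x = h \o (g \o x)); last first.
    by apply/funext => k /=; rewrite gK.
  by rewrite extend_comp sat_Pi0E s0 -sat_Pi0E; exact: uf.
move=> [i [x ux]]; exists i, (h \o x).
rewrite (_ : of_void _ = h \o of_void _) ?extend_comp; last by apply/funext.
case: (sigma2_body i) ux => xi pi /= [uxi upi]; split.
- exact/s0.
- by rewrite sat_Pi0E s0 -sat_Pi0E.
- exact: s1.
- exact: p1.
Qed.

Definition assign (V : Type) (m : nat) (nu : V -> nat) (x : 'I_m -> nat)
  (v : V + 'I_m) : nat := match v with inl w => nu w | inr k => x k end.

(** A reflexive equation is in the diagram exactly when its constant is in the domain, so belonging
    to the domain becomes a finite positive fact. *)
Definition dom_facts (m : nat) (x : 'I_m -> nat) : seq (atom L nat) :=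
  [seq Eq (Leaf (x k)) (Leaf (x k)) | k <- enum 'I_m].

Lemma dom_factsP S m (x : 'I_m -> nat) : [set` dom_facts x] `<=` diag S <->
  exists y : 'I_m -> dom S, forall k, set_val (y k) = x k.
Proof.
split=> [xS|[y yx] phi /= /mapP[k _ ->]]; last first.
  by apply/diag_eqxx; rewrite -yx; exact: set_valP.
have xdom k : dom S (x k).
  by apply/diag_eqxx/xS/mapP; exists k => //; rewrite mem_enum.
by exists (fun k => SigSub (mem_set (xdom k))).
Qed.

Lemma sat_Sigma0_diag S (V : Type) (nu : V -> nat) (u : V -> dom S)
    (F : Sigma0 L V) : (forall v, set_val (u v) = nu v) ->
  sat_Sigma0 u F <-> [set` map (map_atom nu) F] `<=` diag S.
Proof.
move=> uE; rewrite /sat_Sigma0; elim: F => [|phi F IH] //=.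
rewrite IH -(diag_map phi uE); split=> [[p FS] psi /=|FS].
  by rewrite inE => /orP[/eqP ->//|/FS].
by split=> [|psi psiF]; apply: FS; rewrite /= inE ?eqxx ?psiF ?orbT.
Qed.

Lemma assignE S (V : Type) m (nu : V -> nat) (u : V -> dom S)
    (x : 'I_m -> nat) (y : 'I_m -> dom S) :
  (forall v, set_val (u v) = nu v) -> (forall k, set_val (y k) = x k) ->
  forall v, set_val (extend u y v) = assign nu x v.
Proof. by move=> uE yE []. Qed.

Lemma subset_cat_seq (T : eqType) (s t : seq T) (X : set T) :
  [set` s ++ t] `<=` X <-> [set` s] `<=` X /\ [set` t] `<=` X.
Proof.
split=> [stX|[sX tX] x /=]; last by rewrite mem_cat => /orP[/sX|/tX].
by split=> x /= xs; apply: stX; rewrite /= mem_cat xs ?orbT.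
Qed.

(** Naming existential witnesses by numbers turns the formula into a union over countably many
    tuples; the universal part is then violated by finite lists of facts. *)
Lemma Sig2_models K (F : Sigma2 L void) : Sig2 K (fun S => models S F).
Proof.
pose Q i (x : {ffun 'I_(sigma2_arity i) -> nat}) S :=
  exists2 y : 'I_(sigma2_arity i) -> dom S, forall k, set_val (y k) = x k
  & sat_Sigma_and_Pi (extend (of_void (dom S)) y) (sigma2_body (s := F) i).
apply: (@eq_Sig2 _ _ (fun S => exists i x, @Q i x S)).
  move=> S _; split=> [[i [x [y _ ys]]]|[i [y ys]]]; first by exists i, y.
  exists i, [ffun k => set_val (y k)], y => // k; by rewrite ffunE.
apply: Sig2_ex => i; apply: Sig2_ex => x; rewrite /Q.
pose nu : void + 'I_(sigma2_arity i) -> nat := assign (of_void nat) x.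
have nuE S y : (forall k, set_val (y k) = x k) ->
    forall v, set_val (extend (of_void (dom S)) y v) = nu v.
  by move=> yE; apply: assignE.
case: (sigma2_body i) => xi pi /=.
  apply: eq_Sig2 (@Sig2_basic _ K (dom_facts x ++ map (map_atom nu) xi)
    [set map (map_atom nu) pi]) => S _.
  rewrite subset_cat_seq dom_factsP; split=> [[[[y yx] xiS] piS]|].
    exists y => //; rewrite sat_Pi0E !(sat_Sigma0_diag _ (nuE _ _ yx)).
    by split=> //; apply: piS.
  move=> [y yx]; rewrite sat_Pi0E !(sat_Sigma0_diag _ (nuE _ _ yx)) => -[xiS piS].
  by split=> [|_ ->//]; split=> //; exists y.
(* The inner witnesses [z] also become an index. A refuting list says that a tuple [t] lies in the
   domain and makes all the negated atoms of some conjunct true. *)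
apply: (@eq_Sig2 _ _ (fun S => exists k (z : {ffun 'I_(sigma1_arity (s := xi) k) -> nat}),
   [set` dom_facts x ++ dom_facts z ++
         map (map_atom (assign nu z)) (sigma1_body k)] `<=` diag S /\
   forall e, [set e | exists l (t : 'I_(pi1_arity (p := pi) l) -> nat),
       e = dom_facts t ++ map (map_atom (assign nu t)) (pi1_body l)] e ->
       ~ [set` e] `<=` diag S)); last first.
  by apply: Sig2_ex => k; apply: Sig2_ex => z; apply: Sig2_basic.
move=> S _; split=> [[k [z]]|[y yx [[k [t xiS]] piS]]].
  rewrite !subset_cat_seq !dom_factsP => -[[[y yx] [[t tz] xiS]] piS].
  exists y => //; split.
    by exists k, t; apply/(sat_Sigma0_diag _ (assignE (nuE _ _ yx) tz)).
  move=> l w; rewrite sat_Pi0E.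
  pose w' k := set_val (w k).
  rewrite (sat_Sigma0_diag (nu := assign nu w')); last exact: assignE (nuE _ _ yx) _.
  move=> lS; apply: (piS (dom_facts w' ++ map (map_atom (assign nu w')) (pi1_body l))).
    by exists l, w'.
  by rewrite subset_cat_seq dom_factsP; split=> //; exists w.
exists k, [ffun j => set_val (t j)].
have tE j : set_val (t j) = [ffun j => set_val (t j)] j by rewrite ffunE.
rewrite !subset_cat_seq !dom_factsP; split; first split.
- by exists y.
- by split; [exists t|apply/(sat_Sigma0_diag _ (assignE (nuE _ _ yx) tE))].
- move=> _ [l [w' ->]]; rewrite subset_cat_seq dom_factsP => -[[w ww'] lS].
  have := piS l w; rewrite sat_Pi0E; apply.
  by apply/(sat_Sigma0_diag _ (assignE (nuE _ _ yx) ww')).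
Qed.

End FormulasToDiagrams.

(** * Forcing and generic copies *)

Section Forcing.
Variable L : signature.
Implicit Types A S : structure L.

(* The finite sequence [s] of elements of [A] is viewed as the assignment of
   [s_k] to the constant [k] for [k < size s]. *)
Definition realizes A (a0 : dom A) (s : seq (dom A)) (e : seq (atom L nat)) :=
  forall phi, phi \in e ->
    (forall n, occurs n phi -> n < size s) /\ holds (nth a0 s) phi.

Lemma realizes_mkseq A (a0 : dom A) v n e : realizes a0 (mkseq v n) e <->
  forall phi, phi \in e -> (forall k, occurs k phi -> k < n) /\ holds v phi.
Proof.
rewrite /realizes size_mkseq; split=> eP phi /eP[occ vphi]; split=> //.
  by rewrite (eq_holds (u' := nth a0 (mkseq v n))) // => k /occ kn; rewrite nth_mkseq.
by rewrite (eq_holds (u' := v)) // => k /occ kn; rewrite nth_mkseq.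
Qed.

Lemma realizes_cat A (a0 : dom A) s t e :
  realizes a0 s e -> realizes a0 (s ++ t) e.
Proof.
move=> se phi /se[occ sphi]; split.
  by move=> n /occ ns; rewrite size_cat ltn_addr.
by rewrite (eq_holds (u' := nth a0 s)) // => n /occ ns; rewrite nth_cat ns.
Qed.

(** An atomic formula has finitely many leaves, so a directed family that covers them one at a time
    has a member covering them all. *)
Lemma occurs_directed (I : Type) (Q : I -> nat -> Prop) (i0 : I)
    (phi : atom L nat) :
  (forall i j, exists k, forall n, Q i n \/ Q j n -> Q k n) ->
  (forall n, occurs n phi -> exists i, Q i n) ->
  exists i, forall n, occurs n phi -> Q i n.
Proof.
move=> dir.
have fin k (P : 'I_k -> nat -> Prop) :
    (forall j, exists i, forall n, P j n -> Q i n) ->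
    exists i, forall j n, P j n -> Q i n.
  move=> /choice[f fP].
  have [i iP] : exists i, forall j, j \in enum 'I_k -> forall n, Q (f j) n -> Q i n.
    elim: (enum _) => [|j s [i iP]]; first by exists i0.
    have [i' i'P] := dir (f j) i; exists i' => j'.
    rewrite inE => /orP[/eqP ->|/iP j's] n Qn; apply: i'P; first by left.
    by right; exact: j's.
  by exists i => j n /fP; apply: iP; rewrite mem_enum.
have fin2 (P P' : nat -> Prop) : (exists i, forall n, P n -> Q i n) ->
    (exists i, forall n, P' n -> Q i n) ->
    exists i, forall n, P n \/ P' n -> Q i n.
  move=> [i iP] [j jP]; have [k kP] := dir i j.
  by exists k => n [/iP|/jP] Qn; apply: kP; [left|right].
have ter (t : term L nat) : (forall n, leaf_of n t -> exists i, Q i n) ->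
    exists i, forall n, leaf_of n t -> Q i n.
  elim/term_indT: t => [k kl|f ts IH tsl].
    by have [i ik] := kl k erefl; exists i => n ->.
  have [|i iP] := fin _ (fun j n => leaf_of n (ts j)).
    by move=> j; apply: IH => n nj; apply: tsl; exists j.
  by exists i => n [j]; exact: iP.
case: phi => [s t|s t|r ts] /= phil.
- by apply: fin2; apply: ter => n nP; apply: phil; [left|right].
- by apply: fin2; apply: ter => n nP; apply: phil; [left|right].
- have [|i iP] := fin _ (fun j n => leaf_of n (ts j)).
    by move=> j; apply: ter => n nj; apply: phil; exists j.
  by exists i => n [j]; exact: iP.
Qed.

(** The structure of [A] is transported to [N] along the bijection induced by [v], function values
    being sent back by its inverse. *)
Lemma pullback A (N : set nat) (v : nat -> dom A) :
  {in N &, injective v} -> (forall a, exists2 n, N n & v n = a) ->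
  exists2 S, iso A S & forall phi,
    diag S phi <-> (forall n, occurs n phi -> N n) /\ holds v phi.
Proof.
move=> vI vS; pose h (k : N) : dom A := v (set_val k).
have hI : injective h.
  by move=> j k /vI e; apply: val_inj; apply: e; apply/mem_set/set_valP.
have /choice[g gK] a : exists k, h k = a.
  by have [n Nn <-] := vS a; exists (SigSub (mem_set Nn)).
have hK : cancel h g by move=> k; apply: hI; rewrite gK.
have N0 : N !=set0.
  have [a Aa] := dom_neq0 A; have [n Nn _] := vS (SigSub (mem_set Aa)).
  by exists n.
pose S := @Structure L N N0 (fun r a => rel_interp [ffun k => h (a k)])
  (fun f a => g (fun_interp [ffun k => h (a k)])).
have hiso : @isom _ S A h by split=> // f a; rewrite /= gK.
exists S; last by move=> phi; exact: (@diagP _ S A h).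
by apply/iso_sym/isoP; exists h => //; exists g.
Qed.

(** The conditions are repetition-free sequences. Odd stages insert the elements of [A], even stages
    meet [R]; the limit enumerates [A] injectively and is pulled back to a copy, each finite set of
    whose facts is realized at some stage. *)
Lemma generic_copy A (a0 : dom A) (s0 : seq (dom A))
    (R : nat -> seq (dom A) -> Prop) :
  uniq s0 ->
  (forall n s, uniq s -> exists t, uniq (s ++ t) /\ R n (s ++ t)) ->
  exists S (v : nat -> dom A) (l : nat -> nat),
    [/\ iso A S, s0 = mkseq v (l 0) /\ {homo l : m n / m <= n},
        forall n, uniq (mkseq v (l n)),
        forall n, exists m, R n (mkseq v (l m))
      & forall e, [set` e] `<=` diag S <->
                  exists n, realizes a0 (mkseq v (l n)) e].
Proof.
move=> us0 dense.
pose R' n s := if odd n then forall a : dom A, set_val a = n./2 -> a \in s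
               else R n./2 s.
have [|v [l [s0E ul Rl lW]]] :=
    @generic_sequence _ (fun s : seq (dom A) => uniq s) R' a0 s0 us0.
  move=> n s us; rewrite /R'; case: (odd n); last exact: dense.
  have [[a [an nas]]|na] :=
      pselect (exists a : dom A, set_val a = n./2 /\ a \notin s).
    exists [:: a]; rewrite cats1 rcons_uniq nas us; split=> // b.
    by rewrite -an => /val_inj ->; rewrite mem_rcons inE eqxx.
  exists [::]; rewrite cats0; split=> // a an; apply: contrapT => /negP nas.
  by apply: na; exists a.
(* If [A] is finite the lengths are bounded, and [v] is meaningful only on this initial segment. *)
pose N := [set k | exists m, k < l m].
have lI n j k : j < l n -> k < l n -> v j = v k -> j = k.
  move=> jn kn; apply: (mkseq_uniqP v (l n) (ul n)); by rewrite inE.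
have [||S AS diagS] := @pullback A N v.
- move=> j k /set_mem[m jm] /set_mem[n kn]; apply: (lI (maxn m n)).
    by apply: leq_trans jm (lW _ _ (leq_maxl _ _)).
  by apply: leq_trans kn (lW _ _ (leq_maxr _ _)).
- move=> a; have := Rl (set_val a).*2.+1; rewrite /R' /= odd_double /=.
  rewrite uphalf_double => /(_ a erefl)/mapP[k]; rewrite mem_iota /= => kl ->.
  by exists k => //; exists (set_val a).*2.+2.
exists S, v, l; split=> //.
- by move=> n; exists n.*2.+1; have := Rl n.*2; rewrite /R' odd_double doubleK.
- move=> e; split=> [|[n /realizes_mkseq eR] phi /= /eR[occ vphi]]; last first.
  by apply/diagS; split=> // k /occ kn; exists n.
elim: e => [_|phi e IH]; first by exists 0.
rewrite -cat1s => /subset_cat_seq[phiS /IH[n /realizes_mkseq nP]].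
have /diagS[occ vphi] : diag S phi by apply: phiS; rewrite /= inE.
have [|m mP] := @occurs_directed _ (fun m k => k < l m) 0 phi _ occ.
  move=> i j; exists (maxn i j) => k.
  by case=> kl; apply: leq_trans kl (lW _ _ _); rewrite ?leq_maxl ?leq_maxr.
exists (maxn n m); apply/realizes_mkseq => psi; rewrite inE => /orP[/eqP ->|/nP[occ' vpsi]].
  by split=> // k /mP kl; apply: leq_trans kl (lW _ _ (leq_maxr _ _)).
by split=> // k /occ' kl; apply: leq_trans kl (lW _ _ (leq_maxl _ _)).
Qed.

End Forcing.

(** * Sentences expressing that an alternative is forced *)

Section DiagramsToFormulas.
Variable L : signature.
Implicit Types A S : structure L.

Definition bounded (n : nat) (e : seq (atom L nat)) : Prop :=
  forall phi, phi \in e -> forall k, occurs k phi -> k < n.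

(** This is forcing for a difference of open sets: the support is already realized, and no stronger
    condition realizes a refutation. *)
Definition forces A (a0 : dom A) (s : seq (dom A)) (d : seq (atom L nat))
    (E : set (seq (atom L nat))) : Prop :=
  [/\ uniq s, realizes a0 s d
    & forall e t, E e -> uniq (s ++ t) -> ~ realizes a0 (s ++ t) e].

(** Since inequalities are positive atoms, being a repetition-free tuple is expressible
    positively. *)
Definition distinct_facts (n : nat) : seq (atom L nat) :=
  [seq Neq (Leaf i) (Leaf j) | j <- iota 0 n, i <- iota 0 j].

Lemma distinct_factsP A (w : nat -> dom A) n :
  (forall phi, phi \in distinct_facts n -> holds w phi) <-> uniq (mkseq w n).
Proof.
have mem i j : i < j -> j < n -> Neq (Leaf i) (Leaf j) \in distinct_facts n.
  by move=> ij jn; apply/allpairsPdep; exists j, i; rewrite !mem_iota.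
split=> [wd|/mkseq_uniqP wI phi /allpairsPdep[j [i []]]].
  apply/mkseq_uniqP => i j; rewrite !inE => il jl wij.
  by have [/mem/(_ jl)/wd|/mem/(_ il)/wd|//] := ltngtP i j; rewrite /= wij.
rewrite !mem_iota /= => jn ij -> /= /wI; rewrite !inE jn (ltn_trans ij jn).
by move=> /(_ isT isT) eij; rewrite eij ltnn in ij.
Qed.

Lemma forms_realizes A (a0 : dom A) (w : nat -> dom A) (n : nat)
    (s : seq (dom A)) (e : seq (atom L nat)) :
  size s = n -> bounded n e -> (forall k, k < n -> w k = nth a0 s k) ->
  (forall phi, phi \in e ++ distinct_facts n -> holds w phi) <->
  realizes a0 s e /\ uniq s.
Proof.
move=> sn en ws.
have sE : mkseq w n = s.
  by apply: (@eq_from_nth _ a0) => [|k]; rewrite size_mkseq // => kn; rewrite nth_mkseq ?ws.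
rewrite -sE realizes_mkseq -distinct_factsP; split=> [all|[ew dw] phi].
  split=> [phi phie|phi phid]; last by apply: all; rewrite mem_cat phid orbT.
  by split; [exact: en|apply: all; rewrite mem_cat phie].
by rewrite mem_cat => /orP[/ew[]|/dw].
Qed.

(* The constants [k <= m] become the [m.+1] existential variables, the next
   [m'] constants become the universal ones, and the others are irrelevant. *)
Definition var m m' (n : nat) : (void + 'I_m.+1) + 'I_m' :=
  if n < m.+1 then inl (inr (inord n))
  else if insub (n - m.+1) is Some k then inr k else inl (inr ord0).

Lemma extend_var A (a0 : dom A) m m' (s t : seq (dom A))
    (x : 'I_m.+1 -> dom A) (y : 'I_m' -> dom A) :
  size s = m.+1 -> size t = m' ->
  (forall k, x k = nth a0 s k) -> (forall k, y k = nth a0 t k) ->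
  forall n, n < m.+1 + m' ->
    extend (extend (of_void (dom A)) x) y (var m m' n) = nth a0 (s ++ t) n.
Proof.
move=> sm tm xs yt n nmm; rewrite /var nth_cat sm.
case: ifPn => nm /=; first by rewrite xs inordK.
case: insubP => [k _ kn|] /=; first by rewrite yt kn.
by rewrite -leqNgt => ?; lia.
Qed.

Variables (D : nat -> seq (atom L nat)) (E : nat -> set (seq (atom L nat))).

(** The pair [(c, m)] stands for a condition of length [m.+1] forcing the alternative [c]. Positive
    length provides the default variable used in [var]. *)
Definition scott_index : countType :=
  {cm : nat * nat | `[< bounded cm.2.+1 (D cm.1) >]}.

Definition scott_sigma (c m : nat) : Sigma1 L (void + 'I_m.+1) :=
  @MkSigma1 L _ unit (fun=> 0) (fun=>
    map (map_atom (var m 0)) (D c ++ distinct_facts (m.+1 + 0))).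

(** There is one conjunct for each refuting list and each number of further elements; [E c] is
    arbitrary, but the lists form a countable type. *)
Definition scott_pi (c m : nat) : Pi1 L (void + 'I_m.+1) :=
  @MkPi1 L _ {em : seq (atom L nat) * nat |
               `[< E c em.1 /\ bounded (m.+1 + em.2) em.1 >]}
    (fun em => (val em).2) (fun em =>
    map (map_atom (var m (val em).2))
      ((val em).1 ++ distinct_facts (m.+1 + (val em).2))).

Definition scott_sentence : Sigma2 L void :=
  @MkSigma2 L _ scott_index (fun cm => (val cm).2.+1) (fun cm =>
    Beta1 (scott_sigma (val cm).1 (val cm).2) (scott_pi (val cm).1 (val cm).2)).

Lemma models_scott_sentence A (a0 : dom A) : models A scott_sentence <->
  exists c s, 0 < size s /\ forces a0 s (D c) (E c).
Proof.
split=> [[[[c m] /= cmP] [x [[[] [y /sat_Sigma0_map Dx]] Ex]]]|].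
  have /asboolP Dm := cmP.
  pose s := mkseq (fun k => x (inord k)) m.+1.
  have sm : size s = m.+1 by rewrite size_mkseq.
  have xs k : x k = nth a0 s k by rewrite nth_mkseq // inord_val.
  exists c, s; split; first by rewrite sm.
  have /forms_realizes : forall k, k < m.+1 + 0 ->
      (extend (extend (of_void (dom A)) x) y \o var m 0) k = nth a0 s k.
    move=> k km /=; rewrite (@extend_var _ a0 _ _ s [::]) ?cats0 //.
    by case.
  move=> /(_ (D c)) DcP; have {DcP}[| |Ds us] := proj1 (DcP _ _) Dx.
  - by rewrite addn0.
  - by rewrite addn0.
  split=> // e t Ee ust ste.
  (* Being realized by [s ++ t], the list [e] only uses constants that the variables cover, so
     [(e, size t)] indexes a conjunct. *)
  have em : `[< E c e /\ bounded (m.+1 + size t) e >].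
    apply/asboolP; split=> // phi /ste[+ _] k => /[apply].
    by rewrite size_cat sm.
  pose z (k : 'I_(size t)) := nth a0 t k.
  have := Ex (exist _ (e, size t) em) z; rewrite sat_Pi0E; apply.
  apply/sat_Sigma0_map/(@forms_realizes _ a0 _ _ (s ++ t)).
  - by rewrite size_cat sm.
  - by have /asboolP[] := em.
  - by move=> k kl; apply: extend_var.
  - by [].
move=> [c [s [s0 [us Ds Es]]]].
have sm : size s = (size s).-1.+1 by rewrite prednK.
set m := (size s).-1 in sm.
have cm : `[< bounded m.+1 (D c) >].
  by apply/asboolP => phi /Ds[]; rewrite sm.
pose x (k : 'I_m.+1) := nth a0 s k.
exists (exist _ (c, m) cm), x; split.
  have nil0 (k : 'I_0) : dom A by case: k.
  exists tt, nil0; apply/sat_Sigma0_map/(@forms_realizes _ a0 _ _ s).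
  - by rewrite addn0.
  - by rewrite addn0; apply/asboolP.
  - move=> k km /=; rewrite (@extend_var _ a0 _ _ s [::]) ?cats0 //.
    by case.
  - by [].
move=> [[e m'] em] y; rewrite sat_Pi0E; have /asboolP[/= Ee bnd] := em.
pose t := [seq y k | k <- enum 'I_m'].
have tm : size t = m' by rewrite size_map size_enum_ord.
move=> /sat_Sigma0_map /(@forms_realizes _ a0 _ _ (s ++ t)) /= H.
have [|//|k kl|ste ust] := H.
- by rewrite size_cat sm tm.
- apply: extend_var => // j.
  by rewrite (nth_map j) ?size_enum_ord // nth_ord_enum.
- exact: Es ste.
Qed.

(* If [P] holds of every copy of [A], then one of the alternatives defining [P]
   is forced: otherwise a generic copy of [A] would violate all of them. *)
Lemma forcing A (a0 : dom A) :
  (forall S, iso A S -> exists c, [set` D c] `<=` diag S /\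
                         forall e, E c e -> ~ [set` e] `<=` diag S) ->
  exists c s, 0 < size s /\ forces a0 s (D c) (E c).
Proof.
move=> AP; apply: contrapT => nforce.
(* The dense requirement for [c]: a refutation is realized, or no extension realizes the support. *)
pose R c s := (exists2 e, E c e & realizes a0 s e) \/
  forall t, uniq (s ++ t) -> ~ realizes a0 (s ++ t) (D c).
have [//||S [v [l [AS [_ lW] ul Rl diagS]]]] := @generic_copy _ A a0 [:: a0] R.
  move=> c s us.
  have [[t [ust Dst s0]]|nt] := pselect (exists t,
      [/\ uniq (s ++ t), realizes a0 (s ++ t) (D c) & 0 < size (s ++ t)]).
    apply: contrapT => nR; apply: nforce; exists c, (s ++ t); split=> //; split=> //.
    move=> e t' Ee ustt' et'; apply: nR; exists (t ++ t'); rewrite catA.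
    by split=> //; left; exists e.
  (* The preceding case only excludes nonempty extensions, so an empty condition is first lengthened
     by [a0]. *)
  exists (if s is [::] then [:: a0] else [::]).
  case: s us nt => [|a s] us nt; last first.
    by rewrite cats0; split=> //; right=> t ut Dt; apply: nt; exists t.
  by split=> //; right=> t ut Dt; apply: nt; exists (a0 :: t).
have [c [/diagS[n Dn] EcS]] := AP _ AS.
have cat m k : m <= k -> mkseq v (l k) = mkseq v (l m) ++ drop (l m) (mkseq v (l k)).
  move=> /lW mk; rewrite -{1}(cat_take_drop (l m) (mkseq v (l k))).
  by rewrite /mkseq -map_take take_iota (minn_idPl mk).
have [m [[e Ee em]|Rm]] := Rl c.
  by apply: (EcS e Ee); apply/diagS; exists m.
have := Rm (drop (l m) (mkseq v (l (maxn m n)))).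
rewrite -cat ?leq_maxl // => /(_ (ul _)); apply.
by rewrite (cat n) ?leq_maxr //; exact: realizes_cat.
Qed.

(** Every stage of an enumeration of [A] starting with [s] extends [s], so the resulting copy never
    realizes a refutation. *)
Lemma forces_copy A (a0 : dom A) c s : forces a0 s (D c) (E c) ->
  exists2 S, iso A S & [set` D c] `<=` diag S /\
                       forall e, E c e -> ~ [set` e] `<=` diag S.
Proof.
move=> [us Ds Es].
have [|S [v [l [AS [s0 lW] ul _ diagS]]]] :=
    @generic_copy _ A a0 s (fun _ _ => True) us.
  by move=> n t ut; exists [::]; rewrite cats0.
exists S => //; split=> [|e Ee /diagS[n en]]; first by apply/diagS; exists 0; rewrite -s0.
have sE : mkseq v (l n) = s ++ drop (l 0) (mkseq v (l n)).
  rewrite {1}s0 -{1}(cat_take_drop (l 0) (mkseq v (l n))).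
  by rewrite /mkseq -map_take take_iota (minn_idPl (lW _ _ (leq0n n))).
by apply: (Es e (drop (l 0) (mkseq v (l n))) Ee); rewrite -sE; [exact: ul|exact: en].
Qed.

End DiagramsToFormulas.

(** * Equivalence with positive sentences *)

Section SentencesHub.
Variables (L : signature) (B : nat -> structure L).
Hypothesis B_noniso : forall i j : nat, i <> j -> ~ iso (B i) (B j).

Lemma sentences_Sig2 (psi : nat -> Sigma2 L void) :
  (forall i j, models (B j) (psi i) <-> i = j) ->
  forall i, Sig2 (copies B) (iso (B i)).
Proof.
move=> psiP i; apply: eq_Sig2 (Sig2_models _ (psi i)) => S [j jS].
split=> [Spsi|iS]; last by apply: models_iso iS _; exact/psiP.
by have /psiP -> := models_iso (iso_sym jS) Spsi.
Qed.

(** If [B j] forces an alternative for [B i], some copy of [B j] satisfies it and is thus a copy of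
    [B i]. Conversely, all copies of [B i] satisfy an alternative, so [forcing] applies. *)
Lemma Sig2_sentences : (forall i, Sig2 (copies B) (iso (B i))) ->
  exists psi : nat -> Sigma2 L void, forall i j, models (B j) (psi i) <-> i = j.
Proof.
move=> /choice[D /choice[E DEP]].
exists (fun i => scott_sentence (D i) (E i)) => i j.
have [n Bn] := dom_neq0 (B j); pose a0 : dom (B j) := SigSub (mem_set Bn).
rewrite (models_scott_sentence _ _ a0); split=> [[c [s [_ /forces_copy[S jS DES]]]]|ij].
  have iS : iso (B i) S by apply/DEP; [exists j|exists c].
  apply: contrapT => /B_noniso; apply; exact: iso_trans iS (iso_sym jS).
apply: forcing => S; rewrite -ij => iS.
by apply/DEP => //; exists i.
Qed.

End SentencesHub.

(** * Equivalence structures with classes of sizes omega and n *)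

Section EquivalenceStructures.
Implicit Types E : structure eq_signature.

Lemma ffun_ord2 (T : Type) (a : {ffun 'I_2 -> T}) :
  a = [ffun k => if k == ord0 then a ord0 else a ord_max].
Proof.
apply/ffunP => k; rewrite ffunE; case: eqP => [->//|nk].
by congr (a _); apply: val_inj; case: k nk => -[|[|//]] //= p []; exact: val_inj.
Qed.

Lemma iso_simP E E' : iso E E' <-> exists2 h : dom E -> dom E',
  bijective h & forall x y, sim x y <-> sim (h x) (h y).
Proof.
have hE (h : dom E -> dom E') x y :
    [ffun k : 'I_2 => h ([ffun k : 'I_2 => if k == ord0 then x else y] k)] =
    [ffun k : 'I_2 => if k == ord0 then h x else h y].
  by apply/ffunP => k; rewrite !ffunE; case: ifP.
split=> [/isoP[h hbij [hrel _]]|[h hbij hsim]]; apply/isoP || exists h => //.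
  by move=> x y; rewrite /sim hrel hE.
exists h => //; split=> [[] a|[]].
by rewrite (ffun_ord2 a) hE; exact: hsim.
Qed.

Definition sim_atom (x y : nat) : atom eq_signature nat :=
  @Rel eq_signature nat tt [ffun k : 'I_2 => Leaf (if k == ord0 then x else y)].

Lemma diag_sim E (x y : dom E) : diag E (sim_atom (set_val x) (set_val y)) <-> sim x y.
Proof.
pose phi : atom eq_signature bool :=
  @Rel eq_signature bool tt [ffun k : 'I_2 => Leaf (k == ord0)].
have -> : sim_atom (set_val x) (set_val y) =
    map_atom (fun b : bool => if b then set_val x else set_val y) phi.
  by congr Rel; apply/ffunP => k; rewrite !ffunE.
rewrite (diag_map (u := fun b : bool => if b then x else y)); last by case.
rewrite /sim /=.
suff -> : [ffun k => eval (fun b : bool => if b then x else y)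
    ([ffun k0 : 'I_2 => Leaf (k0 == ord0)] k)] =
  [ffun k : 'I_2 => if k == ord0 then x else y] by [].
by apply/ffunP => k; rewrite !ffunE.
Qed.

Lemma diag_simE E x y : diag E (sim_atom x y) -> exists x' y' : dom E,
  [/\ set_val x' = x, set_val y' = y & sim x' y'].
Proof.
move=> Exy.
have Ex : dom E x by apply: (diag_dom Exy); exists ord0; rewrite ffunE.
have Ey : dom E y by apply: (diag_dom Exy); exists ord_max; rewrite ffunE.
exists (SigSub (mem_set Ex)), (SigSub (mem_set Ey)); split=> //.
exact/diag_sim.
Qed.

(* Coordinates witnessing the type [omega : omega, n : omega]: [tag] names the
   class of an element, with first component [true] for infinite classes, and
   [pos] is its position in the class. *)
Definition coordinates n E (tag : dom E -> bool * nat) (pos : dom E -> nat) :=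
  [/\ forall x y, sim x y <-> tag x = tag y,
      forall x y, tag x = tag y -> pos x = pos y -> x = y
    & forall b k t, (exists x, tag x = (b, k) /\ pos x = t) <-> b || (t < n)].

Definition coded n E := exists tag pos, @coordinates n E tag pos.

(** Classes may be named in any type: numbering the names [J] of infinite classes and the names [K]
    of finite ones gives the normal form. *)
Lemma coded_tags n E (T : Type) (tag : dom E -> T) (pos : dom E -> nat)
    (J K : set T) :
  J #= [set: nat] -> K #= [set: nat] -> (forall c, J c -> ~ K c) ->
  (forall x y, sim x y <-> tag x = tag y) ->
  (forall x y, tag x = tag y -> pos x = pos y -> x = y) ->
  (forall c t, (exists x, tag x = c /\ pos x = t) <-> J c \/ K c /\ t < n) ->
  coded n E.
Proof.
move=> /card_set_bijP[f [_ fI fS]] /card_set_bijP[g [_ gI gS]] IF simP posI im.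
pose tag' x := if pselect (J (tag x)) then (true, f (tag x)) else (false, g (tag x)).
have tagF x : ~ J (tag x) -> K (tag x).
  by move=> nI; have [|//|[]] := proj1 (im (tag x) (pos x)); first by exists x.
have tag'P x y : tag' x = tag' y <-> tag x = tag y.
  rewrite /tag'; split=> [|->//].
  case: pselect => xP; case: pselect => yP // [].
    by apply: fI; exact/mem_set.
  by apply: gI; apply/mem_set/tagF.
exists tag', pos; split=> [x y|x y /tag'P|b k t].
- by rewrite tag'P.
- exact: posI.
split=> [[x [tx <-]]|].
  have [|xI|[_ ->]] := proj1 (im (tag x) (pos x)); first by exists x.
    by move: tx; rewrite /tag'; case: pselect => // _ [<-].
  by rewrite orbT.
case: b => /= [_|tn].
  have [c Ic <-] := fS k I; have [x [xc <-]] := proj2 (im c t) (or_introl Ic).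
  by exists x; split=> //; rewrite /tag' xc; case: pselect.
have [c Fc <-] := gS k I; have [x [xc <-]] := proj2 (im c t) (or_intror (conj Fc tn)).
exists x; split=> //; rewrite /tag' xc; case: pselect => // Ic.
by case: (IF c).
Qed.

Lemma class_enum n E tag pos b k : @coordinates n E tag pos ->
  exists f : nat -> dom E,
    (forall t, b || (t < n) -> tag (f t) = (b, k) /\ pos (f t) = t) /\
    (forall x, tag x = (b, k) -> b || (pos x < n) /\ x = f (pos x)).
Proof.
move=> [simP posI im].
have [a Ea] := dom_neq0 E; pose a0 : dom E := SigSub (mem_set Ea).
have /choice[f fP] t : exists x, b || (t < n) -> tag x = (b, k) /\ pos x = t.
  have [/(im _ k)[x xP]|nb] := boolP (b || (t < n)); first by exists x.
  by exists a0.
exists f; split=> // x xb.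
have bx : b || (pos x < n) by apply/(im b k); exists x.
by split=> //; have [tf pf] := fP _ bx; apply: posI; rewrite ?tf ?pf.
Qed.

(** Elements with equal coordinates are matched. *)
Lemma coded_iso n E E' : coded n E -> coded n E' -> iso E E'.
Proof.
move=> [tag [pos [simP posI im]]] [tag' [pos' [simP' posI' im']]].
have /choice[h hP] x : exists y, tag' y = tag x /\ pos' y = pos x.
  by case tx: (tag x) => [b k]; apply/im'/(im b k); exists x.
have /choice[g gP] y : exists x, tag x = tag' y /\ pos x = pos' y.
  by case ty: (tag' y) => [b k]; apply/im/(im' b k); exists y.
apply/iso_simP; exists h.
  exists g => [x|y]; [apply: posI|apply: posI'].
  - by have [-> _] := gP (h x); have [-> _] := hP x.
  - by have [_ ->] := gP (h x); have [_ ->] := hP x.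
  - by have [-> _] := hP (g y); have [-> _] := gP y.
  - by have [_ ->] := hP (g y); have [_ ->] := gP y.
move=> x y; rewrite simP simP'.
by have [-> _] := hP x; have [-> _] := hP y.
Qed.

Lemma iso_coded n E E' : iso E E' -> coded n E -> coded n E'.
Proof.
move=> /iso_simP[h [g hK gK] hsim] [tag [pos [simP posI im]]].
exists (tag \o g), (pos \o g); split=> [x y|x y /= t p|b k t] /=.
- by rewrite -simP hsim !gK.
- by apply: (can_inj gK); apply: posI.
- by rewrite -(im b k); split=> -[x xP]; [exists (g x)|exists (h x); rewrite hK].
Qed.

(** Each class serves as its own name, and a bijection chosen once per class gives the positions. *)
Lemma has_type_coded n E : equivalence_structure E ->
  has_type E [:: ([set: nat], [set: nat]); (`I_n, [set: nat])] -> coded n E.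
Proof.
move=> [rfl sym trans] [card_classes classes].
have eqsim (x y : dom E) : sim x y <-> sim x = sim y.
  split=> [xy|xy]; last by rewrite xy; exact: rfl.
  apply/funext => z; apply/propext; split=> [xz|yz].
    by apply: trans xz; exact: sym.
  exact: trans yz.
have infn (C : set (dom E)) : C #= [set: nat] -> ~ (C #= `I_n).
  by move=> CT CI; apply: infinite_nat; exists n; rewrite -(card_eql CT).
have typ (x : dom E) : sim x #= [set: nat] \/ sim x #= `I_n.
  have [|[a1 a2]] := classes (sim x); first by exists x.
  by rewrite !inE => /orP[/eqP[-> _]|/eqP[-> _]] /= ?; [left|right].
have /choice[p pP] (C : set (dom E)) : exists p : dom E -> nat,
    (C #= [set: nat] -> set_bij C [set: nat] p) /\ (C #= `I_n -> set_bij C `I_n p).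
  have [CT|nCT] := pselect (C #= [set: nat]).
    have /card_set_bijP[p pC] := CT; exists p; split=> // CI.
    by case: (infn C).
  have [/card_set_bijP[p pC]|nCI] := pselect (C #= `I_n); first by exists p.
  by exists (fun=> 0).
apply: (@coded_tags n E (set (dom E)) (@sim E) (fun x => p (sim x) x)
  [set C | sim_classes C /\ C #= [set: nat]]
  [set C | sim_classes C /\ C #= `I_n]).
- by apply: (card_classes ([set: nat], [set: nat])); rewrite inE eqxx.
- by apply: (card_classes (`I_n, [set: nat])); rewrite !inE eqxx orbT.
- by move=> C [_ CT] [_ CI]; apply: (infn C).
- exact: eqsim.
- move=> x y xy; rewrite xy => pxy.
  have pI : set_inj (sim y) (p (sim y)).
    by have [/(proj1 (pP _))[]|/(proj2 (pP _))[]] := typ y.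
  by apply: pI => //; apply/mem_set; [apply/sym/eqsim|apply: rfl].
- move=> C t; split=> [[x [<- <-]]|].
    have [xT|xI] := typ x; [left|right]; first by split=> //; exists x.
    split; first by split=> //; exists x.
    have [+ _ _] := proj2 (pP _) xI; apply; exact: rfl.
  move=> [[[x _ <-] /(proj1 (pP _))[_ _ pS]]|[[[x _ <-] /(proj2 (pP _))[_ _ pS]] tn]].
    by have [y /eqsim -> <-] := pS t I; exists y.
  by have [y /eqsim -> <-] := pS t tn; exists y.
Qed.

Lemma coded_Etilde n E : 0 < n -> coded n E -> Etilde E.
Proof.
move=> n0 [tag [pos crd]]; have [simP posI im] := crd.
have sE : equivalence_structure E.
  split=> [x|x y|x y z]; rewrite !simP //; by move=> ->.
split=> //; exists n => //.
pose cls b k := [set y | tag y = (b, k)].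
pose size_of (b : bool) := if b then [set: nat] else `I_n.
have cls_card b k : cls b k #= size_of b.
  have [f [fP fS]] := class_enum b k crd.
  have szP t : size_of b t <-> b || (t < n) by rewrite /size_of; case: (b).
  have -> : cls b k = f @` size_of b.
    apply/seteqP; split=> [x /fS[bx ->]|_ [t /szP/fP[ft _] <-] //].
    by exists (pos x) => //; apply/szP.
  apply: inj_card_eq => s t /set_mem/szP/fP[_ fs] /set_mem/szP/fP[_ ft] fst.
  by rewrite -fs fst.
have clsE (x : dom E) : sim x = cls (tag x).1 (tag x).2.
  apply/funext => y; apply/propext; rewrite simP /cls /= -surjective_pairing.
  by split=> ->.
(* Every name labels a nonempty class because [0 < n]. *)
have clsP C : sim_classes C <-> exists b k, C = cls b k.
  split=> [[x _ <-]|[b [k ->]]]; first by exists (tag x).1, (tag x).2.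
  have [|x [tx _]] := proj2 (im b k 0); first by rewrite n0 orbT.
  by exists x => //; rewrite clsE tx.
have size_inj b b' : size_of b #= size_of b' -> b = b'.
  case: b; case: b' => // e; case: infinite_nat; exists n => //.
  exact: card_esym.
have cls_inj b : injective (cls b).
  move=> k k' e; have [|x [tx _]] := proj2 (im b k 0); first by rewrite n0 orbT.
  have : cls b k x by [].
  by rewrite e /cls /= tx => -[].
have card_classes b : [set C : set (dom E) | sim_classes C /\ C #= size_of b] #= [set: nat].
  have -> : [set C : set (dom E) | sim_classes C /\ C #= size_of b] = range (cls b).
    apply/seteqP; split=> [C [/clsP[b' [k Ck]] e]|_ [k _ <-]].
      rewrite Ck in e *.
      have -> : b = b'; last by exists k.
      by apply/esym/size_inj; rewrite -(card_eql (cls_card b' k)).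
    by split; [apply/clsP; exists b, k|exact: cls_card].
  by apply: inj_card_eq => k k' _ _; exact: cls_inj.
split=> [ab|C /clsP[b [k ->]]].
  by rewrite !inE => /orP[/eqP ->|/eqP ->]; [exact: (card_classes true)|exact: (card_classes false)].
exists (size_of b, [set: nat]); last exact: cls_card.
by case: (b); rewrite !inE eqxx ?orbT.
Qed.

(** A number [x] outside the domain is listed by the empty sequence; a nonempty [u] therefore
    guarantees a genuine class. *)
Definition lists_class E (u : seq nat) (x : nat) : Prop :=
  forall y, diag E (sim_atom x y) <-> y \in u.

Lemma lists_coded_class n E tag pos (b : bool) k (f : nat -> dom E) : 0 < n ->
  @coordinates n E tag pos ->
  (forall t, b || (t < n) -> tag (f t) = (b, k) /\ pos (f t) = t) ->
  (forall x, tag x = (b, k) -> b || (pos x < n) /\ x = f (pos x)) ->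
  (forall N, b || (N <= n) -> uniq [seq set_val (f t) | t <- iota 0 N]) /\
  forall y, diag E (sim_atom (set_val (f 0)) y) <->
            exists2 t, b || (t < n) & y = set_val (f t).
Proof.
move=> n0 [simP posI im] fP fS; split=> [N Nn|y].
  rewrite map_inj_in_uniq ?iota_uniq // => s t; rewrite !mem_iota /= => sN tN.
  move=> /val_inj fst; have [|_ <-] := fP s; first by case: (b) Nn => //=; lia.
  by have [|_ <-] := fP t; [case: (b) Nn => //=; lia|rewrite fst].
have [|t0 _] := fP 0; first by rewrite n0 orbT.
split=> [/diag_simE[x' [y' [/val_inj -> <- /simP]]]|[t tb ->]].
  rewrite t0 => /esym/fS[y'b ->]; exists (pos y') => //.
apply/diag_sim/simP; rewrite t0; by have [-> _] := fP t tb.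
Qed.

Lemma coded_lists_class n E : 0 < n -> coded n E ->
  exists u x, [/\ uniq u, size u = n & lists_class E u x].
Proof.
move=> n0 [tag [pos crd]]; have [f [fP fS]] := class_enum false 0 crd.
have [uf Ef] := lists_coded_class n0 crd fP fS.
exists [seq set_val (f t) | t <- iota 0 n], (set_val (f 0)); split.
- by apply: uf => /=.
- by rewrite size_map size_iota.
move=> y; rewrite Ef; split=> [[t /= tn ->]|/mapP[t]].
  by apply/mapP; exists t => //; rewrite mem_iota.
by rewrite mem_iota /= => tn ->; exists t.
Qed.

(** With [coded_lists_class] this makes [n] an isomorphism invariant. An infinite class cannot be
    listed, as it has more elements than any [u]; the other classes have exactly [n]. *)
Lemma lists_class_size n E u x : 0 < n -> coded n E -> uniq u -> 0 < size u ->
  lists_class E u x -> size u = n.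
Proof.
move=> n0 [tag [pos crd]] uu u0 ux.
have [x' [y' [xx _ _]]] : exists x' y' : dom E,
    [/\ set_val x' = x, set_val y' = head 0 u & sim x' y'].
  by apply/diag_simE/ux; case: (u) u0 => //= *; rewrite inE eqxx.
case tx: (tag x') => [b k]; have [f [fP fS]] := class_enum b k crd.
have [uf Ef] := lists_coded_class n0 crd fP fS.
have {}ux y : y \in u <-> exists2 t, b || (t < n) & y = set_val (f t).
  have [simP _ _] := crd; have [|t0 _] := fP 0; first by rewrite n0 orbT.
  have fx : sim (f 0) x' by apply/simP; rewrite t0 tx.
  rewrite -ux -Ef -xx; split=> /diag_simE[z [w [/val_inj -> <- /simP zw]]];
    apply/diag_sim/simP; rewrite -zw; first exact/simP.
  exact/esym/simP.
have sub N : b || (N <= n) -> N <= size u.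
  move=> Nn; rewrite -(size_iota 0 N) -(size_map (fun t => set_val (f t))).
  apply: uniq_leq_size; first exact: uf.
  move=> y /mapP[t]; rewrite mem_iota /= => tN ->; apply/ux; exists t => //.
  by case: (b) Nn => //=; lia.
case: b tx fP fS uf Ef ux sub => tx fP fS uf Ef ux sub.
  by have := sub (size u).+1 isT; rewrite ltnn.
apply/eqP; rewrite eqn_leq sub ?leqnn ?andbT //.
rewrite -[leqRHS](size_iota 0) -(size_map (fun t => set_val (f t))).
apply: uniq_leq_size => // y /ux[t /= tn ->]; apply/mapP; exists t => //.
by rewrite mem_iota.
Qed.

End EquivalenceStructures.

(** * From Scott reductions to differences of open sets *)

Section ScottToSig2.
Variables (L : signature) (B : nat -> structure L).
Implicit Type S : structure L.

Definition godels (e : seq (atom L nat)) : Pomega :=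
  [set godel (true, phi) | phi in [set` e]].

Lemma godels_sub S e : [set` e] `<=` diag S -> godels e `<=` Dplus S.
Proof. by rewrite DplusE => eS _ [phi /eS phiS <-]; exists phi. Qed.

Lemma finite_Dplus S (X : set nat) : finite_set X -> X `<=` Dplus S ->
  exists2 e, [set` e] `<=` diag S & X `<=` godels e.
Proof.
move=> /finite_seqP[s ->]; elim: s => [|x s IH] sS; first by exists [::].
have [|e eS se] := IH; first by move=> y ys; apply: sS; rewrite /= inE ys orbT.
have : Dplus S x by apply: sS; rewrite /= inE eqxx.
rewrite DplusE => -[phi phiS xphi]; exists (phi :: e).
  by move=> psi /=; rewrite inE => /orP[/eqP ->|/eS].
move=> y /=; rewrite inE => /orP[/eqP ->|/se[psi psie <-]].
  by exists phi => //=; rewrite inE eqxx.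
by exists psi => //=; rewrite inE psie orbT.
Qed.

Variable Gamma : Pomega -> Pomega.
Hypothesis Gamma_cont : continuous Gamma.

Lemma Gamma_mono X Y : X `<=` Y -> Gamma X `<=` Gamma Y.
Proof. by have [+ _] := proj1 (Scott_continuousP Gamma) Gamma_cont; apply. Qed.

(** Continuity provides a finite support for each entry of [s], and monotonicity lets the supports
    be concatenated. *)
Lemma Gamma_facts S (s : seq nat) : [set` s] `<=` Gamma (Dplus S) <->
  exists2 e, [set` e] `<=` diag S & [set` s] `<=` Gamma (godels e).
Proof.
have [_ fin] := proj1 (Scott_continuousP Gamma) Gamma_cont.
split=> [|[e /godels_sub eS] se]; last exact: subset_trans se (Gamma_mono eS).
elim: s => [|x s IH] sS; first by exists [::].
have [|e eS se] := IH; first by move=> y ys; apply: sS; rewrite /= inE ys orbT.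
have [X [finX XS xX]] : exists X : Pomega,
    [/\ finite_set X, X `<=` Dplus S & Gamma X x].
  by apply: fin; apply: sS; rewrite /= inE eqxx.
have [e' e'S Xe'] := finite_Dplus finX XS.
exists (e ++ e'); first exact/subset_cat_seq.
have [ee ee'] : [set` e] `<=` [set` e ++ e'] /\ [set` e'] `<=` [set` e ++ e'].
  exact/subset_cat_seq.
move=> y; rewrite /= inE => /orP[/eqP ->|/se].
  apply: (Gamma_mono (subset_trans Xe' _)) xX.
  by move=> _ [phi /ee' ? <-]; exists phi.
apply: Gamma_mono => _ [phi /ee ? <-]; by exists phi.
Qed.

(** With [n] the finite class size of [F (B i)], the copies of [B i] are the [S] for which [F S] has
    an n-element class. An alternative is a list [u] of such a class with facts [e] producing it;
    facts that produce a further element refute it. *)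
Lemma Scott_Sig2 (F : structure L -> structure eq_signature) :
  (forall A, copies B A -> Etilde (F A) /\ Gamma (Dplus A) = Dplus (F A)) ->
  (forall A A', copies B A -> copies B A' -> (iso A A' <-> iso (F A) (F A'))) ->
  forall i, Sig2 (copies B) (iso (B i)).
Proof.
move=> FE Fiso i.
have KB : copies B (B i) by exists i; exact: iso_refl.
have [[/has_type_coded cod [n n0 /cod {}cod]] _] := FE _ KB.
pose g x y := godel (true, sim_atom x y).
apply: (@eq_Sig2 _ _ (fun S => exists u x e,
  (uniq u /\ size u = n) /\ ([set` map (g x) u] `<=` Gamma (godels e) /\
  ([set` e] `<=` diag S /\
   forall e', [set e' | exists2 y, y \notin u & Gamma (godels e') (g x y)] e' ->
              ~ [set` e'] `<=` diag S)))); last first.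
  apply: Sig2_ex => u; apply: Sig2_ex => x; apply: Sig2_ex => e.
  by do 2 apply: Sig2_and; exact: Sig2_basic.
move=> S KS; have [[/has_type_coded codS [m m0 /codS {}codS]] FS] := FE _ KS.
have GammaS x y : Gamma (Dplus S) (g x y) <-> diag (F S) (sim_atom x y).
  by rewrite FS; exact: Dplus_godel.
split=> [[u [x [e [[uu un] [ue [eS nou]]]]]]|/(Fiso _ _ KB KS)/iso_coded/(_ cod)].
  have ux : lists_class (F S) u x.
    move=> y; rewrite -GammaS; split=> [xy|yu].
      (* An unlisted element of the class would be produced by finitely many facts of [S], which
         form a refuting list. *)
      apply: contrapT => /negP yu.
      have [|e' e'S ge'] := proj1 (Gamma_facts S [:: g x y]) _.
        by move=> z; rewrite /= inE => /eqP ->.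
      apply: (nou e') => //; exists y => //; apply: ge'; by rewrite /= inE.
    by apply: (proj2 (Gamma_facts S (map (g x) u))); [exists e|exact: map_f].
  have mn : n = m by rewrite -un; apply: lists_class_size codS uu _ ux; rewrite ?un.
  by apply/(Fiso _ _ KB KS); apply: coded_iso cod _; rewrite mn.
move=> /(coded_lists_class n0)[u [x [uu un ux]]].
have [|e eS ue] := proj1 (Gamma_facts S (map (g x) u)) _.
  by move=> _ /= /mapP[y yu ->]; apply/GammaS/ux.
exists u, x, e; split=> //; split=> //; split=> // e' [y yu ye'] e'S.
move/negP: yu; apply; apply/ux/GammaS; exact: (Gamma_mono (godels_sub e'S)).
Qed.

End ScottToSig2.

(** * The reduction to equivalence structures *)

Section Sig2ToScott.
Variables (L : signature) (B : nat -> structure L).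
Hypothesis B_noniso : forall i j : nat, i <> j -> ~ iso (B i) (B j).
Variables (D : nat -> nat -> seq (atom L nat)).
Variables (E : nat -> nat -> set (seq (atom L nat))).
Hypothesis DEP : forall i S, copies B S -> iso (B i) S <->
  exists c, [set` D i c] `<=` diag S /\
            forall e, E i c e -> ~ [set` e] `<=` diag S.

Definition refuted (X : set (atom L nat)) i c :=
  exists2 e, E i c e & [set` e] `<=` X.

(* The class [(true, _)] is infinite and always present. The classes
   [(false, (m, (i, c)))], for all [m], get [i.+1] elements once the alternative
   [c] for [B i] is supported, and become infinite once it is refuted. *)
Definition class_name : countType := (bool * (nat * (nat * nat)))%type.

(** Support and refutation persist when facts are added, so elements never disappear. Positions up
    to and including [i] make the finite sizes [i.+1] positive and distinct for different [i]. *)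
Definition present (X : set (atom L nat)) (p : class_name * nat) : Prop :=
  p.1.1 \/ ([set` D p.1.2.2.1 p.1.2.2.2] `<=` X /\
            (p.2 <= p.1.2.2.1 \/ refuted X p.1.2.2.1 p.1.2.2.2)).

Definition elements X : set nat := [set pickle p | p in present X].

Lemma elements_neq0 X : elements X !=set0.
Proof.
pose p : class_name * nat := ((true, (0, (0, 0))), 0).
by exists (pickle p), p => //; left.
Qed.

Definition name_of (n : nat) : option class_name :=
  omap fst (unpickle n : option (class_name * nat)).

Definition class_structure X : structure eq_signature :=
  @Structure eq_signature (elements X) (elements_neq0 X)
    (fun _ (a : {ffun 'I_2 -> elements X}) =>
       name_of (set_val (a ord0)) = name_of (set_val (a ord_max)))
    (fun f => match f with end).

Lemma elements_mono X Y : X `<=` Y -> elements X `<=` elements Y.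
Proof.
move=> XY _ [p pX <-]; exists p => //; case: pX => [|[DX pX]]; first by left.
right; split; first exact: subset_trans DX XY.
by case: pX => [|[e Ee eX]]; [left|right; exists e => //; exact: subset_trans XY].
Qed.

(* All the [class_structure X] are substructures of a single one. *)
Lemma class_structureP : exists v : nat -> dom (class_structure setT),
  forall X phi, diag (class_structure X) phi <->
    (forall n, occurs n phi -> elements X n) /\ holds v phi.
Proof.
have [r rK] := retraction (class_structure setT); exists r => X phi.
pose h (x : dom (class_structure X)) := r (set_val x).
have hE x : set_val (h x) = set_val x.
  have xT : dom (class_structure setT) (set_val x).
    by apply: (@elements_mono X) => //; exact: set_valP.
  exact: (congr1 set_val (rK (SigSub (mem_set xT)))).
apply: (@diagP _ (class_structure X) _ h) => //.
  by move=> x y /(congr1 set_val); rewrite !hE => /val_inj.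
split=> [r0 a|[]].
by rewrite /= !ffunE !hE.
Qed.

Definition decode (X : Pomega) : set (atom L nat) :=
  [set phi | X (godel (true, phi))].

Definition Gamma (X : Pomega) : Pomega := Dplus (class_structure (decode X)).

Lemma decode_Dplus S : decode (Dplus S) = diag S.
Proof. by apply/funext => phi; apply/propext; exact: Dplus_godel. Qed.

Lemma elements_finite (X : Pomega) n : elements (decode X) n ->
  exists Y : Pomega, [/\ finite_set Y, Y `<=` X & elements (decode Y) n].
Proof.
have finG (e : seq (atom L nat)) : finite_set (godels e).
  by apply: finite_image; exact: finite_seq.
have subG (e : seq (atom L nat)) : [set` e] `<=` decode X -> godels e `<=` X.
  by move=> eX _ [phi /eX ? <-].
have decG (e : seq (atom L nat)) Y : [set` e] `<=` decode (godels e `|` Y).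
  by move=> phi ?; left; exists phi.
move=> [p pX <-]; case: pX => [p1|[DX [tp|[e Ee eX]]]].
- by exists set0; split=> //; exists p => //; left.
- exists (godels (D p.1.2.2.1 p.1.2.2.2) `|` set0); rewrite setU0.
  split=> //; first exact: subG.
  by exists p => //; right; split; [rewrite -[godels _]setU0; exact: decG|left].
- exists (godels (D p.1.2.2.1 p.1.2.2.2) `|` godels e); split.
  + by rewrite finite_setU.
  + by rewrite subUset; split; exact: subG.
  + exists p => //; right; split; first exact: decG.
    by right; exists e => //; rewrite setUC; exact: decG.
Qed.

(** Inside the one ambient structure, a fact of the output only requires its finitely many constants
    to be present, and each of them is present on account of finitely many input facts. *)
Lemma Gamma_continuous : continuous Gamma.
Proof.
have [v vP] := class_structureP.
apply/Scott_continuousP; split=> [X Y XY|X x].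
  rewrite /Gamma !DplusE => _ [phi /vP[occ vphi] <-]; exists phi => //.
  apply/vP; split=> // n /occ; apply: elements_mono => psi; exact: XY.
rewrite /Gamma DplusE => -[phi /vP[occ vphi] <-].
pose I := {Y : Pomega | finite_set Y /\ Y `<=` X}.
pose i0 : I := exist _ set0 (conj (@finite_set0 nat) (@sub0set _ X)).
have [||[Y [fY YX]] Yocc] :=
    @occurs_directed _ I (fun Y n => elements (decode (sval Y)) n) i0 phi.
- move=> [Y [fY YX]] [Z [fZ ZX]].
  have YZ : finite_set (Y `|` Z) /\ Y `|` Z `<=` X.
    by rewrite finite_setU subUset.
  exists (exist _ (Y `|` Z) YZ) => n /=.
  by case; apply: elements_mono => psi; [left|right].
- by move=> n /occ/elements_finite[Y [fY YX Yn]]; exists (exist _ Y (conj fY YX)).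
by exists Y; split=> //; rewrite DplusE; exists phi => //; apply/vP.
Qed.

Lemma card_nat_of_inj (T : countType) (A : set T) (f : nat -> T) :
  injective f -> (forall n, A (f n)) -> A #= [set: nat].
Proof.
move=> fI fA; apply: eq_card_nat; first exact: countableP.
move=> finA; apply: infinite_nat.
have : finite_set (range f) by apply: sub_finite_set finA => _ [n _ <-].
rewrite (eq_finite_set (B := [set: nat])) //.
by apply: inj_card_eq => m n _ _; exact: fI.
Qed.

(** The infinite classes are the permanent ones and those of refuted alternatives; the finite ones
    belong to alternatives true in [S], hence to [B i]. The component [m] gives infinitely many of
    each kind. *)
Lemma class_structure_coded i S : iso (B i) S ->
  coded i.+1 (class_structure (diag S)).
Proof.
move=> iS; have KS : copies B S by exists i.
have /choice[el elP] (x : dom (class_structure (diag S))) :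
    exists p, present (diag S) p /\ pickle p = set_val x.
  by have [p pS px] := set_valP x; exists p.
have nameE x : name_of (set_val x) = Some (el x).1.
  by have [_ <-] := elP x; rewrite /name_of pickleK.
pose supp (p : class_name) := [set` D p.2.2.1 p.2.2.2] `<=` diag S.
pose ref (p : class_name) := refuted (diag S) p.2.2.1 p.2.2.2.
(* A supported, unrefuted alternative makes [S] a copy of the structure it belongs to, which can
   only be [B i]. *)
have goodi (p : class_name) : supp p -> ~ ref p -> p.2.2.1 = i.
  move=> sp nrp; apply: (iso_inj B_noniso) iS; apply/DEP => //.
  by exists p.2.2.2; split=> // e Ee eS; apply: nrp; exists e.
apply: (@coded_tags i.+1 (class_structure (diag S)) class_name
  (fst \o el) (snd \o el) [set p : class_name | p.1 \/ supp p /\ ref p]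
  [set p : class_name | [/\ ~~ p.1, supp p & ~ ref p]]).
- apply: (@card_nat_of_inj _ _ (fun m => (true, (m, (0, 0))))) => [m n []|n] //.
  by left.
- have [c [Dc Ec]] := proj1 (DEP i KS) iS.
  apply: (@card_nat_of_inj _ _ (fun m => (false, (m, (i, c))))) => [m n []|n] //.
  by split=> // -[e /Ec].
- by move=> p /= [p1 [/negP]|[_ rp] [_ _ /(_ rp)]].
- by move=> x y; rewrite /sim /= !ffunE !nameE; split=> [[]|->].
- move=> x y /= x1 x2; apply: val_inj.
  rewrite -[LHS](proj2 (elP x)) -[RHS](proj2 (elP y)).
  by congr pickle; rewrite (surjective_pairing (el x)) x1 x2 -surjective_pairing.
move=> p t /=; split=> [[x [<- <-]]|pt].
  have [[x1|[sx tx]] _] := elP x; first by left; left.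
  have [?|nrx] := pselect (ref (el x).1); first by left; right.
  have [x1|x1] := boolP (el x).1.1; first by left; left.
  right; split=> //; case: tx => // tx.
  by rewrite ltnS -(goodi (el x).1).
have pS : present (diag S) (p, t).
  case: pt => [[p1|[sp rp]]|[[_ sp nrp]]]; [by left|by right; split=> //; right|].
  by rewrite ltnS -(goodi p) // => ti; right; split=> //; left.
have xS : elements (diag S) (pickle (p, t)) by exists (p, t).
exists (SigSub (mem_set xS)); have [_ /= e] := elP (SigSub (mem_set xS)).
by move/(pcan_inj pickleK): e => ->.
Qed.

Lemma class_structure_Scott : Scott_le (copies B) Etilde.
Proof.
exists Gamma; split; first exact: Gamma_continuous.
exists (fun S => class_structure (diag S)); split.
  move=> A [i iA]; split; last by rewrite /Gamma decode_Dplus.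
  exact: (@coded_Etilde i.+1) (class_structure_coded iA).
move=> A A' [i iA] [j jA']; split=> [AA'|].
  have ij : i = j by apply: (iso_inj B_noniso) jA'; exact: iso_trans iA AA'.
  by apply: coded_iso (class_structure_coded iA) _; rewrite ij; exact: class_structure_coded.
move=> /iso_coded/(_ (class_structure_coded iA)) cA'.
have [u [x [uu un ux]]] := coded_lists_class (ltn0Sn i) cA'.
(* The size of a listed class in the image of [A'] recovers the index. *)
have [ij] : i.+1 = j.+1.
  rewrite -un; apply: lists_class_size (ltn0Sn j) (class_structure_coded jA') uu _ ux.
  by rewrite un.
by apply: iso_trans (iso_sym iA) _; rewrite ij.
Qed.

End Sig2ToScott.

(** * Assembling the three equivalences *)

Lemma Sig2_Scott (L : signature) (B : nat -> structure L) :
  (forall i j : nat, i <> j -> ~ iso (B i) (B j)) ->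
  (forall i, Sig2 (copies B) (iso (B i))) -> Scott_le (copies B) Etilde.
Proof.
move=> B_noniso /choice[D /choice[E DEP]].
exact: (@class_structure_Scott _ B B_noniso D E DEP).
Qed.

Theorem theorem3 (L : signature) (B : nat -> structure L)
    (B_noniso : forall i j : nat, i <> j -> ~ iso (B i) (B j)) :
  (TxtEx_learnable B (copies B) <-> Scott_le (copies B) Etilde) /\
  (Scott_le (copies B) Etilde <->
   exists psi : nat -> Sigma2 L void,
     forall i j : nat, models (B j) (psi i) <-> i = j).
Proof.
pose hub := forall i, Sig2 (copies B) (iso (B i)).
have learn : TxtEx_learnable B (copies B) <-> hub.
  by split; [exact: TxtEx_Sig2|exact: Sig2_TxtEx].
have scott : Scott_le (copies B) Etilde <-> hub.
  split; last exact: Sig2_Scott.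
  by move=> [Gamma [cont [F [FE Fiso]]]]; exact: (@Scott_Sig2 _ _ _ cont F FE Fiso).
have sentences : (exists psi : nat -> Sigma2 L void,
    forall i j : nat, models (B j) (psi i) <-> i = j) <-> hub.
  split; last exact: Sig2_sentences.
  by move=> [psi psiP]; exact: sentences_Sig2 psiP.
by rewrite learn scott sentences.
Qed.
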